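(* Let $p\in[1,\infty)$ and $k\in[1,p(p+3)/3)$. Then there exists a positive constant $C$, independent of $f$, such that for every $f\in\mathbb{H}^{1,p}(B_1)$, $$\|f\|_{k,B_1}\le C\,\|(\boldsymbol{\alpha}\cdot\mathbf{p})f\|_{p,B_1}.$$
   Context: $B_1$ is the open unit ball in $\mathbb{R}^3$ centred at the origin. Functions are $\mathbb{C}^4$-valued and $|\cdot|$ is the Euclidean norm on $\mathbb{C}^4$. For $1\le s<\infty$, $\|f\|_{s,B_1}=\left(\int_{B_1}|f(\mathbf{x})|^s\,d\mathbf{x}\right)^{1/s}$. $\boldsymbol{\alpha}=(\alpha_1,\alpha_2,\alpha_3)$ is the triple of Dirac matrices, $\alpha_j=\begin{pmatrix}0_2&\sigma_j\\ \sigma_j&0_2\end{pmatrix}$, where $0_2$ is the $2\times2$ zero matrix and $\sigma_1=\begin{pmatrix}0&1\\1&0\end{pmatrix}$, $\sigma_2=\begin{pmatrix}0&-i\\ i&0\end{pmatrix}$, $\sigma_3=\begin{pmatrix}1&0\\0&-1\end{pmatrix}$. $\mathbf{p}=-i\nabla$, so $\boldsymbol{\alpha}\cdot\mathbf{p}=-i\sum_{j=1}^3\alpha_j\,\partial/\partial x_j$. The Dirac-Sobolev space $\mathbb{H}^{1,p}(B_1)$, $1\le p<\infty$, is the completion of $[C_0^\infty(B_1)]^4$ with respect to the norm $\|f\|_{1,p;B_1}=\left\{\int_{B_1}\left(|(\boldsymbol{\alpha}\cdot\mathbf{p})f|^p+|f|^p\right)d\mathbf{x}\right\}^{1/p}$.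 *)

(* Defs.v *)
From HB Require Import structures.
From mathcomp Require Import all_boot all_order all_algebra.
From mathcomp Require Import complex.
From mathcomp Require Import all_classical all_reals all_analysis.

Set Implicit Arguments.
Unset Strict Implicit.
Unset Printing Implicit Defensive.
Import Order.TTheory GRing.Theory Num.Theory.
Import numFieldNormedType.Exports.
Local Open Scope classical_set_scope.
Local Open Scope complex_scope.
Local Open Scope ring_scope.

(* R * R * R carries the product sigma-algebra and the product topology; its
   library norm is the sup norm, hence the explicit Euclidean unit ball. *)
Definition ball1 (R : realType) : set (R * R * R) :=
  [set x | x.1.1 ^+ 2 + x.1.2 ^+ 2 + x.2 ^+ 2 < 1].

Definition lebesgue3 (R : realType) :
  {measure set (measurableTypeR R * measurableTypeR R * measurableTypeR R)
     -> \bar R} :=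
  ((@lebesgue_measure R \x @lebesgue_measure R) \x @lebesgue_measure R)%E.

Definition basis3 (R : realType) (j : 'I_3) : R * R * R :=
  ((j == 0 :> nat)%:R, (j == 1 :> nat)%:R, (j == 2 :> nat)%:R).

Definition partial (R : realType) (j : 'I_3) (u : R * R * R -> R) :
  R * R * R -> R := fun x => 'D_(basis3 R j) u x.

Fixpoint Cn (R : realType) (n : nat) (u : R * R * R -> R) : Prop :=
  if n is m.+1 then
    continuous u /\
    forall j : 'I_3, (forall x, derivable u x (basis3 R j)) /\ Cn m (partial j u)
  else continuous u.

Definition smooth (R : realType) (u : R * R * R -> R) : Prop :=
  forall n, Cn n u.

(* R[i] has no topology over the field R in the library, so analytic notions
   for C^4-valued functions are stated on the eight real components. *)
Definition re_comp (R : realType) (f : R * R * R -> 'cV[R[i]]_4) (k : 'I_4) :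
  R * R * R -> R := fun x => complex.Re (f x k ord0).

Definition im_comp (R : realType) (f : R * R * R -> 'cV[R[i]]_4) (k : 'I_4) :
  R * R * R -> R := fun x => complex.Im (f x k ord0).

Definition measurable_on_ball (R : realType) (f : R * R * R -> 'cV[R[i]]_4) :
  Prop :=
  forall k, measurable_fun (@ball1 R) (re_comp f k) /\
            measurable_fun (@ball1 R) (im_comp f k).

Definition vnorm (R : realType) (v : 'cV[R[i]]_4) : R :=
  Num.sqrt (\sum_k (complex.Re (v k ord0) ^+ 2 + complex.Im (v k ord0) ^+ 2)).

(* Extensions by zero to the whole space of elements of [C_0^oo(B_1)]^4. *)
Definition test_function (R : realType) (f : R * R * R -> 'cV[R[i]]_4) : Prop :=
  [/\ forall k, smooth (re_comp f k) /\ smooth (im_comp f k),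
      compact (closure [set x | f x != 0]) &
      closure [set x | f x != 0] `<=` @ball1 R].

Definition vpartial (R : realType) (j : 'I_3) (f : R * R * R -> 'cV[R[i]]_4) :
  R * R * R -> 'cV[R[i]]_4 :=
  fun x => \col_k (partial j (re_comp f k) x +i* partial j (im_comp f k) x).

Definition mx2 (T : Type) (a b c d : T) : 'M[T]_2 :=
  \matrix_(r, s) if r == 0 :> nat then (if s == 0 :> nat then a else b)
                 else (if s == 0 :> nat then c else d).

Definition pauli (R : realType) (j : 'I_3) : 'M[R[i]]_2 :=
  match val j with
  | 0%N => mx2 0 1 1 0
  | 1%N => mx2 0 (0 -i* 1) (0 +i* 1) 0
  | _ => mx2 1 0 0 (- 1)
  end.

Definition dirac_alpha (R : realType) (j : 'I_3) : 'M[R[i]]_4 :=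
  block_mx 0 (pauli R j) (pauli R j) 0.

Definition alpha_p (R : realType) (f : R * R * R -> 'cV[R[i]]_4) :
  R * R * R -> 'cV[R[i]]_4 :=
  fun x => (0 -i* 1) *: \sum_(j < 3) dirac_alpha R j *m vpartial j f x.

Definition Lnorm_ball (R : realType) (s : R) (f : R * R * R -> 'cV[R[i]]_4) :
  \bar R :=
  ((\int[@lebesgue3 R]_(x in @ball1 R) (vnorm (f x) `^ s)%:E) `^ s^-1)%E.

(* For g = (alpha . p) f this is the norm of f in H^{1,p}(B_1). *)
Definition graph_norm (R : realType) (p : R)
    (g f : R * R * R -> 'cV[R[i]]_4) : \bar R :=
  ((\int[@lebesgue3 R]_(x in @ball1 R)
      (vnorm (g x) `^ p + vnorm (f x) `^ p)%:E) `^ p^-1)%E.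

(* The completion of the test functions for the norm
   graph_norm p (alpha_p f) f.  As f |-> (alpha_p f, f) is an isometry into the
   complete space L^p x L^p, the completion is the closure of its image: an
   element is a measurable function ds_fun (taken up to equality a.e. on the
   ball) together with ds_dirac, the value at it of the continuous extension of
   alpha_p to the completion. *)
Record dirac_sobolev (R : realType) (p : R) := DiracSobolev {
  ds_fun : R * R * R -> 'cV[R[i]]_4 ;
  ds_dirac : R * R * R -> 'cV[R[i]]_4 ;
  ds_fun_measurable : measurable_on_ball ds_fun ;
  ds_dirac_measurable : measurable_on_ball ds_dirac ;
  ds_approx : exists phi : nat -> R * R * R -> 'cV[R[i]]_4,
    (forall n, test_function (phi n)) /\
    graph_norm p (fun x => alpha_p (phi n) x - ds_dirac x)
                 (fun x => phi n x - ds_fun x) @[n --> \oo] --> 0%E }.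

(* Main.v *)
(* Put D = alpha . grad, so that D^2 is the Laplacian.  With q = |x-y|^2 + e^2,
   the field K = (y-x) q^(-3/2) is a gradient with divergence rho = 3 e^2 q^(-5/2).
   Integrating by parts and using the symmetry of the Jacobian of K together with
   the anticommutation of the Dirac matrices, the mean of a component of a test
   function f against rho is a signed sum of integrals of K against components
   of D f.  As q dominates every z_j^2 + e^2, it dominates their geometric mean,
   so |K| <= H := prod_j (z_j^2 + e^2)^(-1/3), whose r-th power is integrable on
   bounded sets uniformly in e for r < 3/2, by Tonelli and a one-dimensional
   computation.  Young's inequality with 1/r = 1 + 1/k - 1/p, where r < 3/2 because
   k < p(p+3)/3 <= 3p/(3-p) when p < 3, bounds these means in L^k uniformly in e.
   As e -> 0 they converge pointwise to a positive multiple of f (rho is an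
   approximate identity), and Fatou's lemma gives the estimate for f. *)
From HB Require Import structures.
Require Import Defs.
From mathcomp Require Import all_boot all_order all_algebra.
From mathcomp Require Import complex.
From mathcomp Require Import all_classical all_reals all_analysis.
From mathcomp Require Import measurable_realfun.
From mathcomp Require Import ring lra.

Set Implicit Arguments.
Unset Strict Implicit.
Unset Printing Implicit Defensive.
Import Order.TTheory GRing.Theory Num.Theory.
Import numFieldNormedType.Exports.
Local Open Scope classical_set_scope.
Local Open Scope ring_scope.

(** * Measurability and integration by parts in R^3 *)

Section measurability.
Variable R : realType.

(** For [e > 0] the kernel is smooth everywhere, so no ball around the pole has to be cut out, and
    only first partials of [f] ever appear. The product majorant lets every integral be computed in
    Cartesian coordinates. In each coordinate the [r]-th power of [H] has order [2 r / 3], locally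
    integrable exactly when [r < 3/2]; this is also the range for [|z|^(-2)] in dimension three, so
    the majorant costs nothing. The condition on [k] enters through
    [3 / (p (p + 3)) = 1/p - 1/(p + 3)]: it gives [1/r = 1 + 1/k - 1/p > 1 - 1/(p + 3) >= 2/3] for
    all [p] at once, with no case split at [p = 3]. Young's inequality asks for [p <= k]; a smaller
    [k] is reached from the exponent [max p k] on the ball, which has finite measure. Estimates are
    stated with a number [A > 0] bounding the [L^p] norm of [D f]. Such bounds are homogeneous in
    [A], and a vanishing norm is reached by letting [A] decrease to it. In the completion only
    [p]-th powers converge, whereas the [k]-th power is to be bounded; truncation bridges the
    two. *)

Lemma open3_measurable (A : set (R * R * R)) :
  open A -> @measurable _ (measurableTypeR R * measurableTypeR R * measurableTypeR R)%type A.
Proof.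
move=> oA.
(* Boxes with rational centre and radius [1/(n+1)] are countably many, and being products they lie
   in the product sigma-algebra; [A] is the union of those it contains. A radius below [e / 2]
   suffices, since two points of such a box differ by less than [e] in each coordinate. *)
pose bx (i : rat * rat * rat * nat) : set (R * R * R) :=
  ([set x | `|ratr i.1.1.1 - x| < i.2.+1%:R^-1] `*` [set x | `|ratr i.1.1.2 - x| < i.2.+1%:R^-1])
  `*` [set x | `|ratr i.1.2 - x| < i.2.+1%:R^-1].
have mbx i : @measurable _ (measurableTypeR R * measurableTypeR R * measurableTypeR R)%type (bx i).
  have m1 (q : rat) (n : nat) : @measurable _ (measurableTypeR R) [set x : R | `|ratr q - x| < n.+1%:R^-1].
    have -> : [set x : R | `|ratr q - x| < n.+1%:R^-1] = ball (ratr q : R) n.+1%:R^-1.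
      by apply/seteqP; split => x /=.
    exact: open_measurable (ball_open _ _).
  by apply: measurableX => //; apply: measurableX.
have -> : A = \bigcup_(i in [set i | bx i `<=` A]) bx i.
  apply/seteqP; split; last by move=> x [i /= bA]; exact: bA.
  move=> [[x y] z] Ax.
  have := oA; rewrite openE => /(_ _ Ax) /nbhs_ballP[e /= e0 xA].
  have [n] : exists n : nat, n.+1%:R^-1 < e / 2.
    exists (Num.truncn (2 / e)).
    rewrite invf_plt ?posrE ?divr_gt0// invf_div.
    exact: truncnS_gt.
  move=> ne.
  have n0 : (0 : R) < n.+1%:R^-1 by [].
  have rq (t : R) : exists q : rat, `|ratr q - t| < n.+1%:R^-1.
    have tt : t - n.+1%:R^-1 < t + n.+1%:R^-1 by rewrite ltrD2l gtrN.
    have [q] := rat_in_itvoo tt.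
    rewrite in_itv/= => /andP[a b]; exists q.
    by rewrite ltr_distl a.
  have [[q1 h1] [[q2 h2] [q3 h3]]] := (rq x, (rq y, rq z)).
  exists (q1, q2, q3, n) => //= -[[x' y'] z'] /= [[/= k1 k2] /= k3].
  have tr (q t t' d : R) : d < e / 2 -> `|q - t| < d -> `|q - t'| < d -> `|t - t'| < e.
    rewrite !ltr_norml => ? /andP[? ?] /andP[? ?]; apply/andP; split; lra.
  by apply: xA; split; [split|] => /=; rewrite /ball/=; [exact: tr ne h1 k1|exact: tr ne h2 k2|exact: tr ne h3 k3].
have -> : \bigcup_(i in [set i | bx i `<=` A]) bx i =
    \bigcup_n (if unpickle n is Some i then if `[< bx i `<=` A >] then bx i else set0 else set0).
  apply/seteqP; split => [x [i /= bA bx_x]|x [n _]].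
    by exists (pickle i); [exact: I|rewrite pickleK; case: asboolP].
  by case: unpickle => [i|] //; case: asboolP => // bA bx_x; exists i.
by apply: bigcupT_measurable => n; case: unpickle => [i|] //; case: asboolP.
Qed.

Lemma continuous3_measurable (u : R * R * R -> R) : continuous u ->
  @measurable_fun _ _ (measurableTypeR R * measurableTypeR R * measurableTypeR R)%type (measurableTypeR R) setT u.
Proof.
move=> /continuousP cu; apply: (measurability _ (RGenOpens.measurableE R)).
move=> _ [_ [a [b ->] <-]]; rewrite setTI; apply: open3_measurable.
exact/cu/interval_open.
Qed.

Lemma ball1_coord (x : R * R * R) : @ball1 R x ->
  [/\ `|x.1.1| < 1, `|x.1.2| < 1 & `|x.2| < 1].
Proof.
rewrite /ball1/=; have := sqr_ge0 x.1.1; have := sqr_ge0 x.1.2; have := sqr_ge0 x.2.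
by move=> *; split; rewrite -(ltr_pXn2r (n:=2)) ?nnegrE// real_normK ?num_real// expr1n; lra.
Qed.

Lemma continuous_coord :
  continuous (fun x : R * R * R => x.1.1) /\ continuous (fun x : R * R * R => x.1.2) /\ continuous (fun x : R * R * R => x.2).
Proof.
split; [|split].
- by move=> x; apply: (@continuous_comp _ _ _ fst fst); exact: cvg_fst.
- by move=> x; apply: (@continuous_comp _ _ _ fst snd); [exact: cvg_fst|exact: cvg_snd].
- by move=> x; exact: cvg_snd.
Qed.

Lemma ball1_open : open (@ball1 R).
Proof.
have -> : @ball1 R = (fun x : R * R * R => x.1.1 ^+ 2 + x.1.2 ^+ 2 + x.2 ^+ 2) @^-1` [set y | y < 1].
  by [].
apply: open_comp; last exact: open_lt.
have [c1 [c2 c3]] := continuous_coord.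
move=> x _; apply: cvgD; first apply: cvgD.
- exact: (continuous_comp (c1 x) (@exprn_continuous R 2 _)).
- exact: (continuous_comp (c2 x) (@exprn_continuous R 2 _)).
- exact: (continuous_comp (c3 x) (@exprn_continuous R 2 _)).
Qed.

Lemma ball1_measurable : @measurable _ (measurableTypeR R * measurableTypeR R * measurableTypeR R)%type (@ball1 R).
Proof. exact: open3_measurable ball1_open. Qed.

End measurability.

Section sigma_finite_product.
Context d1 d2 (T1 : measurableType d1) (T2 : measurableType d2) (R : realType).
Variables (m1 : {sigma_finite_measure set T1 -> \bar R})
          (m2 : {sigma_finite_measure set T2 -> \bar R}).

(* The library declares the sigma-finite instance of [m1 \x m2] only after one
   for finite measures, which hides it; hence this alias. *)
Definition sprod : set (T1 * T2) -> \bar R := (m1 \x m2)%E.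

HB.instance Definition _ := Measure.copy sprod (m1 \x m2)%E.

Lemma sprod_sigma_finite : sigma_finite setT sprod.
Proof.
have [F TF Foo] := sigma_finiteT m1; have [G TG Goo] := sigma_finiteT m2.
exists (fun n => if unpickle n is Some (i, j) then F i `*` G j else set0).
  apply/seteqP; split => // -[x y] _.
  have [i _ Fx] : (\bigcup_i F i) x by rewrite -TF.
  have [j _ Gy] : (\bigcup_i G i) y by rewrite -TG.
  by exists (pickle (i, j)) => //; rewrite pickleK.
move=> n; case: unpickle => [[i j]|]; last by split => //; rewrite measure0.
have [? ?] := Foo i; have [? ?] := Goo j; split; first exact: measurableX.
by rewrite /sprod product_measure1E// lte_mul_pinfty// ge0_fin_numE.
Qed.

HB.instance Definition _ := Measure_isSigmaFinite.Build _ _ _ sprod sprod_sigma_finite.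

End sigma_finite_product.

Lemma continuous_pair (T U V : topologicalType) (f : T -> U) (g : T -> V) :
  continuous f -> continuous g -> continuous (fun x => (f x, g x)).
Proof.
by move=> cf cg x; apply: (@cvg_pair _ _ _ (nbhs x) (nbhs (f x)) (nbhs (g x))); [exact: cf|exact: cg].
Qed.

Section integration.
Variable R : realType.
Notation mR := (measurableTypeR R).
Notation mR3 := (mR * mR * mR)%type.
Notation mu := (@lebesgue_measure R).
Notation mu3 := (@lebesgue3 R).
Notation mu2 := (sprod mu mu).

Lemma bounded_supp_integrable d (T : measurableType d) (m : {measure set T -> \bar R})
    (D : set T) (w : T -> R) (M : R) :
  measurable D -> (m D < +oo)%E -> measurable_fun setT w ->
  (forall x, `|w x| <= M) -> (forall x, ~ D x -> w x = 0) ->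
  m.-integrable setT (EFin \o w).
Proof.
move=> mD Doo mw wM w0.
have -> : EFin \o w = (EFin \o w) \_ D.
  by apply/funext => x; rewrite patchE; case: ifPn => //; rewrite notin_setE => /w0 /= ->.
apply/(integrable_mkcond _ mD); apply: measurable_bounded_integrable => //.
  exact: measurable_funTS.
exists M; split; first by rewrite num_real.
by move=> N MN x _ /=; rewrite (le_trans (wM x))// ltW.
Qed.

Lemma lebesgue3E : mu3 = ((mu \x mu) \x mu)%E :> (set mR3 -> \bar R).
Proof. by []. Qed.

Lemma lebesgue_measure_itv11 : mu (`[(-1 : R), 1]%classic : set mR) = 2%:E.
Proof. by rewrite lebesgue_measure_itv/= lte_fin ifT; [rewrite -EFinD; congr EFin; lra|lra]. Qed.

(** A substitute for the closed ball: its measure is read off from its factors, and its compactness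
    bounds the continuous functions that vanish off the ball. *)
Definition box3 : set mR3 := (`[-1, 1] `*` `[-1, 1]) `*` `[-1, 1].

Lemma box3_measurable : measurable box3.
Proof. by apply: measurableX => //; apply: measurableX. Qed.

Lemma box3_fin : (mu3 box3 < +oo)%E.
Proof.
rewrite lebesgue3E /box3 product_measure1E//=; last exact: measurableX.
by rewrite product_measure1E//= !lebesgue_measure_itv11; exact: ltry.
Qed.

Lemma box2_fin : ((mu \x mu) (`[(-1)%R : R, 1%R] `*` `[(-1)%R : R, 1%R] : set (mR * mR)) < +oo)%E.
Proof. by rewrite product_measure1E//= !lebesgue_measure_itv11; exact: ltry. Qed.

Lemma ball1_sub_box3 : @ball1 R `<=` box3.
Proof.
move=> [[x y] z] /ball1_coord[/= xb yb zb]; rewrite /box3/= !in_itv/= -!ler_norml.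
by rewrite !ltW.
Qed.

Lemma ball1_fin : (mu3 (@ball1 R) < +oo)%E.
Proof.
apply: le_lt_trans box3_fin; apply: le_measure; rewrite ?inE.
- exact: ball1_measurable.
- exact: box3_measurable.
- exact: ball1_sub_box3.
Qed.

Lemma continuous_ball_bounded (w : R * R * R -> R) : continuous w ->
  (forall x, ~ ball1 x -> w x = 0) -> exists M, forall x, `|w x| <= M.
Proof.
move=> cw w0.
have cB : compact box3.
  by apply: compact_setX; [apply: compact_setX|]; exact: segment_compact.
have /compact_bounded[M [_ Mw]] := continuous_compact (continuous_subspaceT cw) cB.
(* [M + 1] because the bound holds only strictly above [M]; the absolute value makes the sum
   nonnegative, as needed where [w] vanishes, [M] having no known sign. *)
exists (M + 1 + `|M + 1|) => x.
have [bx|nbx] := pselect (ball1 x); last first.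
  rewrite w0// normr0; have := ler_norm (- (M + 1)); rewrite normrN; lra.
rewrite (le_trans (Mw (M + 1) _ _ _))//=.
- by rewrite ltrDl.
- by exists x => //; exact: ball1_sub_box3.
- by rewrite lerDl.
Qed.

Lemma continuous_ball_integrable (w : R * R * R -> R) : continuous w ->
  (forall x, ~ ball1 x -> w x = 0) -> mu3.-integrable setT (EFin \o w).
Proof.
move=> cw w0; have [M wM] := continuous_ball_bounded cw w0.
apply: (@bounded_supp_integrable _ mR3 mu3 (@ball1 R) w M) => //.
- exact: ball1_measurable.
- exact: ball1_fin.
- exact: continuous3_measurable.
Qed.

Lemma integral3_last (F : mR3 -> \bar R) : mu3.-integrable setT F ->
  (\int[mu3]_x F x = \int[mu2]_a \int[mu]_z F (a, z))%E.
Proof. by move=> iF; exact: (esym (@integral12_prod_meas1 _ _ _ _ _ mu2 mu F iF)). Qed.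

Lemma integral3_first (F : mR3 -> \bar R) : mu3.-integrable setT F ->
  (\int[mu3]_x F x = \int[mu]_z \int[mu2]_a F (a, z))%E.
Proof. by move=> iF; exact: (esym (@integral21_prod_meas1 _ _ _ _ _ mu2 mu F iF)). Qed.

Definition upd (j : 'I_3) (a : R * R * R) (t : R) : R * R * R :=
  match val j with
  | 0%N => (t, a.1.2, a.2) | 1%N => (a.1.1, t, a.2) | _ => (a.1.1, a.1.2, t)
  end.

(** Fubini with the [j]-th coordinate innermost. For the last coordinate one exchange is enough; for
    the other two the last coordinate is put outermost and the plane integral over each slice is
    split again. *)
Lemma integral_lines0 (j : 'I_3) (F : R * R * R -> R) : continuous F ->
  (forall x, ~ ball1 x -> F x = 0) ->
  (forall a, \int[mu]_t (F (upd j a t))%:E = 0)%E ->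
  (\int[mu3]_x (F x)%:E = 0)%E.
Proof.
move=> cF F0 Fj; have iF := continuous_ball_integrable cF F0.
have [M FM] := continuous_ball_bounded cF F0.
have i2 (z : R) : mu2.-integrable setT (fun x => (F (x, z))%:E).
  apply: (@bounded_supp_integrable _ (mR * mR)%type mu2 (`[-1, 1] `*` `[-1, 1]) (fun x => F (x, z)) M) => //.
  - exact: measurableX.
  - exact: box2_fin.
  - apply: (measurableT_comp (continuous3_measurable cF)).
    exact: (measurable_pair2 (z : mR)).
  - move=> x bx; apply: F0 => /ball1_sub_box3; case=> //.
case: j Fj => -[|[|[|//]]] /= lj Fj.
- rewrite integral3_first//; apply: integral0_eq => z _.
  apply: (etrans (esym (@integral21_prod_meas1 _ _ _ _ _ mu mu _ (i2 z)))).
  by apply: integral0_eq => y _; exact: Fj ((0, y), z).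
- rewrite integral3_first//; apply: integral0_eq => z _.
  apply: (etrans (esym (@integral12_prod_meas1 _ _ _ _ _ mu mu _ (i2 z)))).
  by apply: integral0_eq => x _; exact: Fj ((x, 0), z).
- rewrite integral3_last//; apply: integral0_eq => -[x y] _.
  exact: Fj ((x, y), 0).
Qed.

Lemma derive_line (w : R * R * R -> R) j a t :
  derivable w (upd j a t) (basis3 R j) ->
  is_derive t (1:R) (fun s => w (upd j a s)) (partial j w (upd j a t)).
Proof.
have E (h : R) : h *: basis3 R j + upd j a t = upd j a (h *: (1:R) + t).
  case: j => -[|[|[|//]]] lj; rewrite /upd/basis3/=;
  by congr (_, _, _); rewrite /= ?[_ *: _]mulr0 ?add0r.
have Ef : (fun h => h^-1 *: ((w \o shift (upd j a t)) (h *: basis3 R j) - w (upd j a t))) =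
    (fun h => h^-1 *: (((fun s => w (upd j a s)) \o shift t) (h *: (1 : R)) - w (upd j a t))).
  by apply/funext => h /=; rewrite E.
move=> dw; split; last by rewrite /partial /derive Ef.
by move: dw; rewrite /derivable Ef.
Qed.

Lemma integral_derive0 (f f' : R -> R) : (forall t, is_derive t (1:R) f (f' t)) ->
  continuous f' -> (forall t, 1 <= `|t| -> f t = 0) -> (forall t, 1 <= `|t| -> f' t = 0) ->
  (\int[mu]_t (f' t)%:E = 0)%E.
Proof.
move=> df cf' f0 f'0.
have cf : continuous f.
  by move=> t; apply: differentiable_continuous; apply/derivable1_diffP; case: (df t).
transitivity (\int[mu]_(t in `[(-2)%R, 2%R]) (f' t)%:E)%E.
  rewrite [RHS]integral_mkcond; apply: eq_integral => t _.
  rewrite patchE; case: ifPn => //; rewrite notin_setE/= in_itv/= -ler_norml => /negP.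
  by rewrite -ltNge => t2; rewrite f'0//; lra.
rewrite (@continuous_FTC2 _ f' f).
- by rewrite !f0 ?subee// ?normrN ger0_norm; lra.
- lra.
- exact: continuous_subspaceT.
- split.
  + by move=> x _; case: (df x).
  + by apply: cvg_at_right_filter; exact: cf.
  + by apply: cvg_at_left_filter; exact: cf.
- by move=> x _; rewrite derive1E; apply: derive_val; exact: df.
Qed.

(** The divergence theorem without boundary term: on each line parallel to the [j]-th axis the
    fundamental theorem of calculus compares two values of [w] outside the ball. *)
Lemma integral_partial0 (j : 'I_3) (w w' : R * R * R -> R) :
  (forall x, derivable w x (basis3 R j)) -> partial j w = w' -> continuous w' ->
  (forall x, ~ ball1 x -> w x = 0) -> (forall x, ~ ball1 x -> w' x = 0) ->
  (\int[mu3]_x (w' x)%:E = 0)%E.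
Proof.
move=> dw <- cw w0 w'0; apply: (integral_lines0 (j := j)) => // a.
have cu : continuous (upd j a).
  case: j {dw cw w'0} => -[|[|[|//]]] lj t; rewrite /upd/=; move: t.
  - by apply: continuous_pair; [apply: continuous_pair|] => y; [exact: cvg_id|exact: cvg_cst..].
  - by apply: continuous_pair; [apply: continuous_pair|] => y; [exact: cvg_cst|exact: cvg_id|exact: cvg_cst].
  - by apply: continuous_pair => y; [exact: cvg_cst|exact: cvg_id].
have nb t : 1 <= `|t| -> ~ ball1 (upd j a t).
  move=> t1 /ball1_coord; case: j {dw cw w'0 cu} => -[|[|[|//]]] lj; rewrite /upd/= => -[];
  by rewrite !ltNge ?t1.
apply: (@integral_derive0 (fun t => w (upd j a t))).
- by move=> t; exact: derive_line.
- by move=> t; apply: (continuous_comp (cu t)); exact: cw.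
- by move=> t /nb; exact: w0.
- by move=> t /nb; exact: w'0.
Qed.

End integration.

(** * The regularised kernel *)

Section kernel.
Variable R : realType.
Notation mR := (measurableTypeR R).
Notation mR3 := (mR * mR * mR)%type.
Notation mu3 := (@lebesgue3 R).

Definition coord (j : 'I_3) (y : R * R * R) : R :=
  match val j with 0%N => y.1.1 | 1%N => y.1.2 | _ => y.2 end.

Lemma upd_coord j y : upd j y (coord j y) = y.
Proof. by case: y => -[a b] c; case: j => -[|[|[|//]]] lj. Qed.

Lemma coord_upd j k y t : coord j (upd k y t) = if j == k then t else coord j y.
Proof. by case: j => -[|[|[|//]]] lj; case: k => -[|[|[|//]]] lk. Qed.

(** The way back from [derive_line]: partial derivatives of the kernel are obtained from
    one-variable calculus on coordinate lines. *)
Lemma is_derive_line (w : R * R * R -> R) j y d :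
  is_derive (coord j y) (1:R) (fun s => w (upd j y s)) d -> is_derive y (basis3 R j) w d.
Proof.
set t := coord j y.
have E (h : R) : h *: basis3 R j + upd j y t = upd j y (h *: (1:R) + t).
  case: j @t => -[|[|[|//]]] lj t; rewrite /upd/basis3/=;
  by congr (_, _, _); rewrite /= ?[_ *: _]mulr0 ?add0r.
have Ef : (fun h => h^-1 *: ((w \o shift (upd j y t)) (h *: basis3 R j) - w (upd j y t))) =
    (fun h => h^-1 *: (((fun s => w (upd j y s)) \o shift t) (h *: (1 : R)) - w (upd j y t))).
  by apply/funext => h /=; rewrite E.
rewrite -{2}(upd_coord j y) -/t => -[dw <-]; split; last by rewrite /derive Ef.
by move: dw; rewrite /derivable Ef.
Qed.

Lemma is_derive_coord j k y : is_derive y (basis3 R k) (coord j) (j == k)%:R.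
Proof.
apply: is_derive_line.
under eq_fun do rewrite coord_upd.
by case: eqP => _; [exact: is_derive_id|exact: is_derive_cst].
Qed.

Lemma is_derive_comp_powR (g : R * R * R -> R) a k y dg : (forall y, 0 < g y) ->
  is_derive y (basis3 R k) g dg ->
  is_derive y (basis3 R k) (fun y => g y `^ a) (a * g y `^ (a - 1) * dg).
Proof.
move=> g0 dgy.
have dg1 : is_derive (coord k y) (1:R) (fun s => g (upd k y s)) dg.
  have := @derive_line R g k y (coord k y); rewrite upd_coord => /(_ _).
  rewrite /partial; case: dgy => dgy ->; exact.
apply: is_derive_line.
have dp : is_derive (g (upd k y (coord k y))) (1:R) (fun z => z `^ a) (a * g y `^ (a - 1)).
  by rewrite upd_coord; exact: is_derive1_powR.
exact: (@is_derive1_comp _ (fun z => z `^ a) (fun s => g (upd k y s)) _ _ _ dp dg1).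
Qed.

Lemma continuous_coordj j : continuous (coord j).
Proof.
have [c1 [c2 c3]] := continuous_coord R.
by case: j => -[|[|[|//]]] lj; [exact: c1|exact: c2|exact: c3].
Qed.

Lemma continuous_comp_powR (T : topologicalType) (g : T -> R) a : (forall y, 0 < g y) ->
  continuous g -> continuous (fun y => g y `^ a).
Proof.
move=> g0 cg y; apply: (@continuous_comp _ _ _ g (fun z => z `^ a)); first exact: cg.
apply: differentiable_continuous; apply/derivable1_diffP.
by case: (is_derive1_powR a (g0 y)).
Qed.

Variables (e : R) (x : R * R * R).
Hypothesis e0 : 0 < e.

Definition dist2e (y : R * R * R) : R := \sum_(j < 3) (coord j y - coord j x) ^+ 2 + e ^+ 2.

Lemma dist2e_gt0 y : 0 < dist2e y.
Proof. by rewrite ltr_wpDl ?exprn_gt0// sumr_ge0// => j _; exact: sqr_ge0. Qed.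

Definition kap (a : R) y := dist2e y `^ a.

(* The gradient of [- dist2e ^ (-1/2)], a regularised Newton potential. *)
Definition Kj (j : 'I_3) y := (coord j y - coord j x) * kap (- (3 / 2)) y.

(** The Jacobian of [Kj], that is the Hessian of the regularised potential, written out so that its
    symmetry is visible. *)
Definition Qjk (j k : 'I_3) y := (j == k)%:R * kap (- (3 / 2)) y
  - 3 * (coord j y - coord j x) * (coord k y - coord k x) * kap (- (3 / 2) - 1) y.

Definition rho y := 3 * e ^+ 2 * kap (- (3 / 2) - 1) y.

Lemma QjkC j k : Qjk j k = Qjk k j.
Proof.
by apply/funext => y; rewrite /Qjk eq_sym; congr (_ - _ * _); rewrite mulrAC.
Qed.

Lemma kap_step y : kap (- (3 / 2)) y = dist2e y * kap (- (3 / 2) - 1) y.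
Proof.
have d0 := dist2e_gt0 y.
rewrite /kap -{2}(powRr1 (ltW d0)) -powRD; first by congr (_ `^ _); lra.
by rewrite (gt_eqF d0) implybT.
Qed.

(** Over the common power [q^(-5/2)] the trace is [3 q - 3 (q - e^2) = 3 e^2]: the unregularised
    potential is harmonic away from its pole, so only the contribution of [e] survives. *)
Lemma sum_Qjj y : \sum_(j < 3) Qjk j j y = rho y.
Proof.
rewrite /rho /Qjk; under eq_bigr do rewrite eqxx kap_step.
rewrite /dist2e !big_ord_recl !big_ord0 /=.
set k := kap _ _; ring.
Qed.

Lemma is_derive_dist2e k y : is_derive y (basis3 R k) dist2e (2 * (coord k y - coord k x)).
Proof.
have d j : is_derive y (basis3 R k) (fun y => (coord j y - coord j x) ^+ 2)
    (2 * (coord j y - coord j x) * (j == k)%:R).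
  have dc := is_derive_coord j k y.
  rewrite (_ : (fun y => _) = (coord j - cst (coord j x)) * (coord j - cst (coord j x))); last first.
    by apply/funext => z; rewrite expr2.
  apply: is_derive_eq.
  by rewrite subr0 /GRing.scale/= !fctE /=; ring.
rewrite (_ : dist2e = \sum_(j < 3) (fun y => (coord j y - coord j x) ^+ 2) + cst (e ^+ 2)); last first.
  by apply/funext => z; rewrite /dist2e fctE fct_sumE.
apply: is_derive_eq.
rewrite addr0 (bigD1 k)//= eqxx mulr1 big1 ?addr0// => j /negbTE ->.
by rewrite mulr0.
Qed.

Lemma is_derive_Kj j k y : is_derive y (basis3 R k) (Kj j) (Qjk j k y).
Proof.
have dc := is_derive_coord j k y.
have dk := is_derive_comp_powR (- (3 / 2)) dist2e_gt0 (is_derive_dist2e k y).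
rewrite (_ : Kj j = (coord j - cst (coord j x)) * kap (- (3 / 2))) //.
apply: is_derive_eq.
rewrite /Qjk /kap /= subr0 /GRing.scale/=.
have -> : (coord j - cst (coord j x)) y = coord j y - coord j x by [].
by field.
Qed.

Lemma continuous_dist2e : continuous dist2e.
Proof.
move=> y; apply: cvgD; last exact: cvg_cst.
apply: (@cvg_big R _ +%R) => [|j _]; first exact: add_continuous.
apply: (@continuous_comp _ _ _ (fun y => coord j y - coord j x) (fun z => z ^+ 2)).
  by apply: cvgB; [exact: continuous_coordj|exact: cvg_cst].
exact: exprn_continuous.
Qed.

Lemma continuous_kap a : continuous (kap a).
Proof. exact: continuous_comp_powR dist2e_gt0 continuous_dist2e. Qed.

Lemma continuous_Kj j : continuous (Kj j).
Proof.
move=> y; apply: cvgM; last exact: continuous_kap.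
by apply: cvgB; [exact: continuous_coordj|exact: cvg_cst].
Qed.

Lemma continuous_Qjk j k : continuous (Qjk j k).
Proof.
move=> y; apply: cvgB; first by apply: cvgM; [exact: cvg_cst|exact: continuous_kap].
apply: cvgM; last exact: continuous_kap.
apply: cvgM; last by apply: cvgB; [exact: continuous_coordj|exact: cvg_cst].
apply: cvgM; [exact: cvg_cst|].
by apply: cvgB; [exact: continuous_coordj|exact: cvg_cst].
Qed.

Lemma continuous_rho : continuous rho.
Proof. by move=> y; apply: cvgM; [exact: cvg_cst|exact: continuous_kap]. Qed.

(* [dist2e] dominates each of these factors' bases, hence their geometric mean:
   [Hker] is a separable majorant of [Kj]. *)
Definition hker (j : 'I_3) y := ((coord j y - coord j x) ^+ 2 + e ^+ 2) `^ (- (1 / 3)).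

Definition Hker y := \prod_(j < 3) hker j y.

(** The linear factor is at most [q^(1/2)], so [|Kj|] is at most [q^(-1)], which is the product of
    three factors [q^(-1/3)], one for each coordinate. *)
Lemma normr_Kj_le j y : `|Kj j y| <= Hker y.
Proof.
have d0 := dist2e_gt0 y.
have h1 k : (coord k y - coord k x) ^+ 2 + e ^+ 2 <= dist2e y.
  rewrite lerD2r (bigD1 k)//= lerDl; apply: sumr_ge0 => i _; exact: sqr_ge0.
have h2 k : 0 < (coord k y - coord k x) ^+ 2 + e ^+ 2.
  by rewrite ltr_wpDl ?sqr_ge0// exprn_gt0.
have cd : `|coord j y - coord j x| <= dist2e y `^ (1 / 2).
  rewrite div1r powR12_sqrt ?(ltW d0)// -sqrtr_sqr; apply: ler_wsqrtr.
  by apply: le_trans (h1 j); rewrite lerDl sqr_ge0.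
rewrite /Kj normrM (ger0_norm (powR_ge0 _ _)).
apply: (@le_trans _ _ (dist2e y `^ (1 / 2) * kap (- (3 / 2)) y)).
  by rewrite ler_wpM2r// powR_ge0.
have -> : dist2e y `^ (1 / 2) * kap (- (3 / 2)) y = \prod_(k < 3) dist2e y `^ (- (1 / 3)).
  rewrite prodr_const card_ord -powR_mulrn ?powR_ge0// -powRrM /kap -powRD.
    by congr (_ `^ _); field.
  by rewrite (gt_eqF d0) implybT.
apply: ler_prod => k _; rewrite powR_ge0/= /hker !powRN.
rewrite lef_pV2 ?posrE ?powR_gt0//.
by apply: ge0_ler_powR; [lra|rewrite nnegrE ltW..|exact: h1].
Qed.

End kernel.

(** * Integration by parts against the kernel *)

Section parts.
Variable R : realType.
Notation mR := (measurableTypeR R).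
Notation mR3 := (mR * mR * mR)%type.
Notation mu3 := (@lebesgue3 R).

Definition cball (w : R * R * R -> R) := continuous w /\ forall x, ~ ball1 x -> w x = 0.

(** All the regularity that the integrations by parts use: the second derivatives fall on the
    potential, never on [u]. *)
Definition C1ball (u : R * R * R -> R) := cball u /\
  forall j, (forall x, derivable u x (basis3 R j)) /\ cball (partial j u).

Lemma cball_mul (k w : R * R * R -> R) : continuous k -> cball w -> cball (fun y => k y * w y).
Proof.
move=> ck [cw w0]; split; last by move=> y /w0 ->; rewrite mulr0.
by move=> y; apply: cvgM; [exact: ck|exact: cw].
Qed.

Lemma cball_integrable w : cball w -> mu3.-integrable setT (EFin \o w).
Proof. by move=> [cw w0]; exact: continuous_ball_integrable. Qed.

Lemma cballD w1 w2 : cball w1 -> cball w2 -> cball (fun y => w1 y + w2 y).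
Proof.
move=> [c1 z1] [c2 z2]; split; last by move=> y ny; rewrite z1// z2// addr0.
by move=> y; apply: cvgD; [exact: c1|exact: c2].
Qed.

Lemma cballZ c w : cball w -> cball (fun y => c * w y).
Proof. by move=> cw; apply: cball_mul => // y; exact: cvg_cst. Qed.

Variables (e : R) (x : R * R * R).
Hypothesis e0 : 0 < e.

Definition Lj (j : 'I_3) (w : R * R * R -> R) : R := \int[mu3]_y (Kj e x j y * w y).

(** The product rule makes the sum of the two integrands the [k]-th partial of [Kj * u], whose
    integral is zero. *)
Lemma Lj_partial j k u : C1ball u -> Lj j (partial k u) = - \int[mu3]_y (Qjk e x j k y * u y).
Proof.
move=> [cu du]; have [dku cku] := du k.
have c1 : cball (fun y => Qjk e x j k y * u y) by apply: cball_mul => //; exact: continuous_Qjk.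
have c2 : cball (fun y => Kj e x j y * partial k u y) by apply: cball_mul => //; exact: continuous_Kj.
have dw y : is_derive y (basis3 R k) (fun y => Kj e x j y * u y)
    (Qjk e x j k y * u y + Kj e x j y * partial k u y).
  have dK := is_derive_Kj x e0 j k y.
  have duy : is_derive y (basis3 R k) u (partial k u y) by split.
  have := is_deriveM dK duy; congr (is_derive _ _ _ _).
  by rewrite /GRing.scale/= addrC [u y * _]mulrC.
have I0 : (\int[mu3]_y (Qjk e x j k y * u y + Kj e x j y * partial k u y)%:E = 0)%E.
  apply: (@integral_partial0 _ k (fun y => Kj e x j y * u y)).
  - by move=> y; case: (dw y).
  - by apply/funext => y; rewrite /partial; case: (dw y).
  - by case: (cballD c1 c2).
  - by case: (cball_mul (@continuous_Kj R e x e0 j) cu).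
  - by case: (cballD c1 c2).
apply/eqP; rewrite -addr_eq0 /Lj addrC -RintegralD//; try exact: cball_integrable.
by rewrite /Rintegral I0.
Qed.

(** The gradient field [K] has no curl; this symmetry is what kills the mixed terms in the Dirac
    algebra below. *)
Lemma Lj_partialC j k u : C1ball u -> Lj j (partial k u) = Lj k (partial j u).
Proof. by move=> cu; rewrite !Lj_partial// QjkC. Qed.

Lemma Lj_trace u : C1ball u -> \sum_(j < 3) Lj j (partial j u) = - \int[mu3]_y (rho e x y * u y).
Proof.
move=> cu; under eq_bigr do rewrite Lj_partial//.
rewrite sumrN; congr (- _).
have cQ j : cball (fun y => Qjk e x j j y * u y).
  by apply: cball_mul; [exact: continuous_Qjk|case: cu].
transitivity (\int[mu3]_y (\sum_(j < 3) (Qjk e x j j y * u y))); last first.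
  by apply: eq_Rintegral => y _; rewrite -mulr_suml sum_Qjj.
rewrite !big_ord_recl !big_ord0 addr0.
under [RHS]eq_Rintegral do rewrite !big_ord_recl !big_ord0 addr0.
rewrite [RHS]RintegralD//; [|exact: cball_integrable|]; last first.
  by apply: (@cball_integrable (fun y => _ + _)); apply: cballD.
by rewrite RintegralD//; exact: cball_integrable.
Qed.

(** Three terms, because each real component of the Dirac operator is a signed sum of three
    partials. *)
Lemma Lj_lin j c1 c2 c3 w1 w2 w3 : cball w1 -> cball w2 -> cball w3 ->
  Lj j (fun y => c1 * w1 y + c2 * w2 y + c3 * w3 y) = c1 * Lj j w1 + c2 * Lj j w2 + c3 * Lj j w3.
Proof.
move=> W1 W2 W3.
have cK w : cball w -> cball (fun y => Kj e x j y * w y).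
  by apply: cball_mul; exact: continuous_Kj.
have iZ c w : cball w -> mu3.-integrable setT (EFin \o (fun y => c * (Kj e x j y * w y))).
  by move=> W; apply: cball_integrable; apply: cballZ; exact: cK.
have Z c w : cball w -> c * Lj j w = \int[mu3]_y (c * (Kj e x j y * w y)).
  by move=> W; rewrite RintegralZl//; exact: cball_integrable (cK _ W).
rewrite !Z// -RintegralD//; [|exact: iZ..].
rewrite -RintegralD//; [|by apply: (@cball_integrable (fun y => _ + _)); apply: cballD; apply: cballZ; exact: cK|exact: iZ].
by apply: eq_Rintegral => y _; ring.
Qed.

Lemma Lj_le j w (N : R * R * R -> R) : cball w -> (forall y, `|w y| <= N y) ->
  @measurable_fun _ _ mR3 mR (@ball1 R) N ->
  (`|Lj j w|%:E <= \int[mu3]_(y in @ball1 R) (Hker e x y * N y)%:E)%E.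
Proof.
move=> W wN mN.
have cKw : cball (fun y => Kj e x j y * w y) by apply: cball_mul => //; exact: continuous_Kj.
have mB := @ball1_measurable R.
rewrite /Lj EFin_normr_Rintegral//; last exact: cball_integrable.
apply: (le_trans (le_abse_integral _ _ _)) => //.
  by apply/measurable_EFinP; apply: continuous3_measurable; case: cKw.
rewrite [leLHS](_ : _ = \int[mu3]_(y in @ball1 R) (`|Kj e x j y * w y|)%:E)%E; last first.
  rewrite [RHS]integral_mkcond; apply: eq_integral => y _; rewrite patchE.
  have [//|ny] := boolP (y \in @ball1 R).
  by move: ny; rewrite notin_setE => ny /=; rewrite (proj2 cKw _ ny) normr0.
apply: ge0_le_integral => //.
- apply/measurable_EFinP; apply: measurableT_comp => //; apply: measurable_funTS.
  by apply: continuous3_measurable; case: cKw.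
- apply/measurable_EFinP; apply: measurable_funM => //; apply: measurable_funTS.
  apply: continuous3_measurable.
  apply: (@continuous_big R _ *%R); first exact: mul_continuous.
  move=> k _; apply: continuous_comp_powR.
    by move=> y; rewrite ltr_wpDl ?sqr_ge0// exprn_gt0.
  move=> y; apply: cvgD; last exact: cvg_cst.
  apply: (@continuous_comp _ _ _ (fun y => coord k y - coord k x) (fun z => z ^+ 2)).
    by apply: cvgB; [exact: continuous_coordj|exact: cvg_cst].
  exact: exprn_continuous.
- move=> y _; rewrite lee_fin normrM ler_pM//.
  exact: normr_Kj_le.
Qed.

Notation j1 := (@ord0 2).
Notation j2 := (lift ord0 (@ord0 1) : 'I_3).
Notation j3 := (lift ord0 (lift ord0 (@ord0 0)) : 'I_3).

Lemma sum3 (V : zmodType) (F : 'I_3 -> V) : \sum_(j < 3) F j = F j1 + F j2 + F j3.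
Proof. by rewrite !big_ord_recl big_ord0 addr0 addrA. Qed.

(** In the use below, [A0 j k] is the pairing of [Kj j] with the [k]-th partial of [a0], and
    likewise for the others. For the spinor [psi = (a0 + i b0, a1 + i b1)], [P0 + i Q0] and
    [P1 + i Q1] are then the components of [(sigma . p) psi]. The four identities are the real and
    imaginary parts of [(sigma . K)(sigma . p) = K . p + i sigma . (K x p)], whose cross product
    vanishes because the arrays are symmetric. *)
Lemma dirac_algebra (A0 B0 A1 B1 : 'I_3 -> 'I_3 -> R) :
  (forall j k, A0 j k = A0 k j) -> (forall j k, B0 j k = B0 k j) ->
  (forall j k, A1 j k = A1 k j) -> (forall j k, B1 j k = B1 k j) ->
  let P0 j := 1 * B0 j j3 + 1 * B1 j j1 + (-1) * A1 j j2 in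
  let Q0 j := (-1) * A0 j j3 + (-1) * A1 j j1 + (-1) * B1 j j2 in
  let P1 j := 1 * B0 j j1 + 1 * A0 j j2 + (-1) * B1 j j3 in
  let Q1 j := (-1) * A0 j j1 + 1 * B0 j j2 + 1 * A1 j j3 in
  [/\ - (A0 j1 j1 + A0 j2 j2 + A0 j3 j3) = Q0 j3 + Q1 j1 - P1 j2,
      - (B0 j1 j1 + B0 j2 j2 + B0 j3 j3) = - P0 j3 - P1 j1 - Q1 j2,
      - (A1 j1 j1 + A1 j2 j2 + A1 j3 j3) = Q0 j1 - Q1 j3 + P0 j2 &
      - (B1 j1 j1 + B1 j2 j2 + B1 j3 j3) = - P0 j1 + P1 j3 + Q0 j2].
Proof.
move=> sA0 sB0 sA1 sB1 P0 Q0 P1 Q1; rewrite /P0 /Q0 /P1 /Q1.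
rewrite (sA0 j2 j1) (sA0 j3 j1) (sA0 j3 j2) (sB0 j2 j1) (sB0 j3 j1) (sB0 j3 j2).
rewrite (sA1 j2 j1) (sA1 j3 j1) (sA1 j3 j2) (sB1 j2 j1) (sB1 j3 j1) (sB1 j3 j2).
by split; ring.
Qed.

(** Two-component spinors suffice: the Dirac matrices exchange the two halves of a vector of [C^4]
    and act on each half by Pauli matrices. *)
Lemma dirac_spinor_pair (a0 b0 a1 b1 : R * R * R -> R) :
  C1ball a0 -> C1ball b0 -> C1ball a1 -> C1ball b1 ->
  let P0 y := 1 * partial j3 b0 y + 1 * partial j1 b1 y + (-1) * partial j2 a1 y in
  let Q0 y := (-1) * partial j3 a0 y + (-1) * partial j1 a1 y + (-1) * partial j2 b1 y in
  let P1 y := 1 * partial j1 b0 y + 1 * partial j2 a0 y + (-1) * partial j3 b1 y in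
  let Q1 y := (-1) * partial j1 a0 y + 1 * partial j2 b0 y + 1 * partial j3 a1 y in
  [/\ \int[mu3]_y (rho e x y * a0 y) = Lj j3 Q0 + Lj j1 Q1 - Lj j2 P1,
      \int[mu3]_y (rho e x y * b0 y) = - Lj j3 P0 - Lj j1 P1 - Lj j2 Q1,
      \int[mu3]_y (rho e x y * a1 y) = Lj j1 Q0 - Lj j3 Q1 + Lj j2 P0 &
      \int[mu3]_y (rho e x y * b1 y) = - Lj j1 P0 + Lj j3 P1 + Lj j2 Q0].
Proof.
move=> A0 B0 A1 B1 P0 Q0 P1 Q1.
have cp u j : C1ball u -> cball (partial j u) by case=> _ /(_ j)[].
have T u : C1ball u -> \int[mu3]_y (rho e x y * u y) =
    - (Lj j1 (partial j1 u) + Lj j2 (partial j2 u) + Lj j3 (partial j3 u)).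
  by move=> U; rewrite -(sum3 (fun j => Lj j (partial j u))) (Lj_trace U) opprK.
have EP0 j : Lj j P0 = _ := Lj_lin j 1 1 (-1) (cp _ j3 B0) (cp _ j1 B1) (cp _ j2 A1).
have EQ0 j : Lj j Q0 = _ := Lj_lin j (-1) (-1) (-1) (cp _ j3 A0) (cp _ j1 A1) (cp _ j2 B1).
have EP1 j : Lj j P1 = _ := Lj_lin j 1 1 (-1) (cp _ j1 B0) (cp _ j2 A0) (cp _ j3 B1).
have EQ1 j : Lj j Q1 = _ := Lj_lin j (-1) 1 1 (cp _ j1 A0) (cp _ j2 B0) (cp _ j3 A1).
clearbody P0 Q0 P1 Q1.
rewrite (T _ A0) (T _ B0) (T _ A1) (T _ B1) !EP0 !EQ0 !EP1 !EQ1.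
have S u (U : C1ball u) j k : Lj j (partial k u) = Lj k (partial j u) := Lj_partialC j k U.
exact: (dirac_algebra (S _ A0) (S _ B0) (S _ A1) (S _ B1)).
Qed.

End parts.

(** * The Dirac operator in real components, and the bound on the means *)

Section dirac.
Local Open Scope complex_scope.
Variable R : realType.
Notation mR := (measurableTypeR R).
Notation mR3 := (mR * mR * mR)%type.
Notation mu3 := (@lebesgue3 R).
Notation j1 := (@ord0 2).
Notation j2 := (lift ord0 (@ord0 1) : 'I_3).
Notation j3 := (lift ord0 (lift ord0 (@ord0 0)) : 'I_3).

Lemma partial_eq0 (u : R * R * R -> R) (K : set (R * R * R)) j x :
  closed K -> (forall y, ~ K y -> u y = 0) -> ~ K x -> partial j u x = 0.
Proof.
move=> cK u0 Kx; rewrite /partial (@near_eq_derive _ _ _ u (cst 0)).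
  exact: derive_cst.
have : nbhs x (~` K) by apply: open_nbhs_nbhs; split => //; exact: closed_openC.
by apply: filterS => y /u0.
Qed.

Lemma smooth_C1ball (u : R * R * R -> R) (K : set (R * R * R)) : smooth u ->
  closed K -> K `<=` @ball1 R -> (forall y, ~ K y -> u y = 0) -> C1ball u.
Proof.
move=> su cK KB u0; have [cu du] := su 1%N.
have nK y : ~ ball1 y -> ~ K y by move=> ny /KB.
split; first by split => // y /nK /u0.
move=> j; have [dj cj] := du j; split => //; split => // y /nK.
exact: partial_eq0.
Qed.

Lemma test_function_C1ball (f : R * R * R -> 'cV[R[i]]_4) k : test_function f ->
  C1ball (re_comp f k) /\ C1ball (im_comp f k).
Proof.
move=> [sf _ fB]; have [sr si] := sf k.
have cK : closed (closure [set x | f x != 0]) by exact: closed_closure.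
have f0 y : ~ closure [set x | f x != 0] y -> f y = 0.
  by move=> ny; apply/eqP/negPn/negP => fy; apply: ny; exact: subset_closure.
by split; apply: smooth_C1ball cK fB _ => // y /f0 fy; rewrite /re_comp /im_comp fy mxE.
Qed.

(** [b] selects the upper or the lower half, so that the off-diagonal block form of the Dirac
    matrices becomes negation of [b] and both halves are treated at once. *)
Definition half (b : bool) (r : 'I_2) : 'I_4 := if b then lshift 2 r else rshift 2 r.

Lemma halfP (k : 'I_4) : exists b r, k = half b r.
Proof.
by case: (splitP (k : 'I_(2 + 2))) => r kr; [exists true, r|exists false, r];
  apply/val_inj; rewrite /= kr.
Qed.

Lemma dirac_alphaE j (v : 'cV[R[i]]_4) b r :
  (dirac_alpha R j *m v) (half (~~ b) r) ord0 = \sum_s pauli R j r s * v (half b s) ord0.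
Proof.
rewrite mxE (@big_split_ord _ _ +%R 2 2 xpredT
  (fun i => dirac_alpha R j (half (~~ b) r) i * v i ord0)) /=.
have z (g : 'I_2 -> R[i]) : \sum_(i < 2) 0 * g i = 0 by rewrite big1// => i _; rewrite mul0r.
have Edl i : dirac_alpha R j (rshift 2 r : 'I_(2 + 2)) (lshift 2 i : 'I_(2 + 2)) = pauli R j r i.
  exact: block_mxEdl.
have Eur i : dirac_alpha R j (lshift 2 r : 'I_(2 + 2)) (rshift 2 i : 'I_(2 + 2)) = pauli R j r i.
  exact: block_mxEur.
have Edr i : dirac_alpha R j (rshift 2 r : 'I_(2 + 2)) (rshift 2 i : 'I_(2 + 2)) = 0.
  by rewrite [LHS]block_mxEdr mxE.
have Eul i : dirac_alpha R j (lshift 2 r : 'I_(2 + 2)) (lshift 2 i : 'I_(2 + 2)) = 0.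
  by rewrite [LHS]block_mxEul mxE.
case: b; rewrite /half /=.
  under [X in X + _]eq_bigr do rewrite Edl.
  under [X in _ + X]eq_bigr do rewrite Edr.
  by rewrite z addr0.
under [X in X + _]eq_bigr do rewrite Eul.
under [X in _ + X]eq_bigr do rewrite Eur.
by rewrite z add0r.
Qed.

Notation r0 := (@ord0 1).
Notation r1 := (lift ord0 (@ord0 0) : 'I_2).

Lemma dirac_symbol (A B : 'I_3 -> 'I_2 -> R) :
  let S r := (0 -i* 1) * \sum_(j < 3) \sum_(s < 2) pauli R j r s * (A j s +i* B j s) in
  S r0 = (1 * B j3 r0 + 1 * B j1 r1 + (-1) * A j2 r1) +i*
         ((-1) * A j3 r0 + (-1) * A j1 r1 + (-1) * B j2 r1) /\
  S r1 = (1 * B j1 r0 + 1 * A j2 r0 + (-1) * B j3 r1) +i*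
         ((-1) * A j1 r0 + 1 * B j2 r0 + 1 * A j3 r1).
Proof.
have E r : \sum_(j < 3) \sum_(s < 2) pauli R j r s * (A j s +i* B j s) =
   pauli R j1 r r0 * (A j1 r0 +i* B j1 r0) + pauli R j1 r r1 * (A j1 r1 +i* B j1 r1) +
   (pauli R j2 r r0 * (A j2 r0 +i* B j2 r0) + pauli R j2 r r1 * (A j2 r1 +i* B j2 r1)) +
   (pauli R j3 r r0 * (A j3 r0 +i* B j3 r0) + pauli R j3 r r1 * (A j3 r1 +i* B j3 r1)).
  have s2 (F : 'I_2 -> R[i]) : \sum_(s < 2) F s = F r0 + F r1.
    by rewrite !big_ord_recl big_ord0 addr0.
  by rewrite sum3 !s2.
move=> S; rewrite /S !E /pauli /mx2 !mxE /=.
by split; apply/eqP; rewrite eq_complex /=; apply/andP; split; apply/eqP; ring.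
Qed.

Lemma alpha_pE (f : R * R * R -> 'cV[R[i]]_4) b x :
  let a0 := re_comp f (half b r0) in let b0 := im_comp f (half b r0) in
  let a1 := re_comp f (half b r1) in let b1 := im_comp f (half b r1) in
  alpha_p f x (half (~~ b) r0) ord0 =
    (1 * partial j3 b0 x + 1 * partial j1 b1 x + (-1) * partial j2 a1 x) +i*
    ((-1) * partial j3 a0 x + (-1) * partial j1 a1 x + (-1) * partial j2 b1 x) /\
  alpha_p f x (half (~~ b) r1) ord0 =
    (1 * partial j1 b0 x + 1 * partial j2 a0 x + (-1) * partial j3 b1 x) +i*
    ((-1) * partial j1 a0 x + 1 * partial j2 b0 x + 1 * partial j3 a1 x).
Proof.
move=> a0 b0 a1 b1.
have E r : alpha_p f x (half (~~ b) r) ord0 =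
  (0 -i* 1) * \sum_(j < 3) \sum_(s < 2) pauli R j r s *
   (partial j (re_comp f (half b s)) x +i* partial j (im_comp f (half b s)) x).
  rewrite /alpha_p mxE summxE; congr (_ * _); apply: eq_bigr => j _.
  by rewrite dirac_alphaE; apply: eq_bigr => s _; rewrite mxE.
by rewrite !E; exact: (dirac_symbol (fun j s => partial j (re_comp f (half b s)) x)
  (fun j s => partial j (im_comp f (half b s)) x)).
Qed.

Lemma vnorm_ge0 (v : 'cV[R[i]]_4) : 0 <= vnorm v.
Proof. exact: sqrtr_ge0. Qed.

Lemma normr_comp_le (v : 'cV[R[i]]_4) k :
  `|complex.Re (v k ord0)| <= vnorm v /\ `|complex.Im (v k ord0)| <= vnorm v.
Proof.
pose F k := complex.Re (v k ord0) ^+ 2 + complex.Im (v k ord0) ^+ 2.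
have F0 l : 0 <= F l by rewrite addr_ge0// sqr_ge0.
have Fk : F k <= \sum_l F l.
  by rewrite (bigD1 k)//= lerDl; apply: sumr_ge0 => l _; exact: F0.
rewrite -!sqrtr_sqr /vnorm; split; apply: ler_wsqrtr; apply: le_trans Fk;
  by rewrite /F ?lerDl ?lerDr sqr_ge0.
Qed.

Lemma measurable_vnorm (D : set mR3) (g : R * R * R -> 'cV[R[i]]_4) :
  (forall k, @measurable_fun _ _ mR3 mR D (re_comp g k) /\
             @measurable_fun _ _ mR3 mR D (im_comp g k)) ->
  @measurable_fun _ _ mR3 mR D (fun y => vnorm (g y)).
Proof.
move=> mg; apply: (@measurableT_comp _ _ _ _ _ _ (@Num.sqrt R)).
  by apply: continuous_measurable_fun; exact: sqrt_continuous.
apply: measurable_sum => k; have [mr mi] := mg k.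
by apply: measurable_funD; apply: measurable_funX.
Qed.

Lemma cball_lin c1 c2 c3 (w1 w2 w3 : R * R * R -> R) : cball w1 -> cball w2 -> cball w3 ->
  cball (fun y => c1 * w1 y + c2 * w2 y + c3 * w3 y).
Proof. by move=> *; apply: cballD; [apply: cballD|]; exact: cballZ. Qed.

Lemma alpha_p_cball (f : R * R * R -> 'cV[R[i]]_4) k : test_function f ->
  cball (re_comp (alpha_p f) k) /\ cball (im_comp (alpha_p f) k).
Proof.
move=> tf; have [b [r ->]] := halfP k.
have cp l j : cball (partial j (re_comp f l)) /\ cball (partial j (im_comp f l)).
  by have [[_ /(_ j)[_ ?]] [_ /(_ j)[_ ?]]] := test_function_C1ball l tf.
have cr l j := (cp l j).1; have ci l j := (cp l j).2.
(* The index is turned into the shape [half (~~ b) r], under which [alpha_pE] computes the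
   components. *)
rewrite -(negbK b); move: (~~ b) => {}b.
have E y := alpha_pE f b y.
case: r => -[|[|//]] lr.
- have -> : half (~~ b) (Ordinal lr) = half (~~ b) r0 by congr half; exact: val_inj.
  split.
  + rewrite (_ : re_comp _ _ = fun y => complex.Re (alpha_p f y (half (~~ b) r0) ord0)) //.
    by under eq_fun do rewrite (E _).1; exact: cball_lin.
  + rewrite (_ : im_comp _ _ = fun y => complex.Im (alpha_p f y (half (~~ b) r0) ord0)) //.
    by under eq_fun do rewrite (E _).1; exact: cball_lin.
- have -> : half (~~ b) (Ordinal lr) = half (~~ b) r1 by congr half; exact: val_inj.
  split.
  + rewrite (_ : re_comp _ _ = fun y => complex.Re (alpha_p f y (half (~~ b) r1) ord0)) //.
    by under eq_fun do rewrite (E _).2; exact: cball_lin.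
  + rewrite (_ : im_comp _ _ = fun y => complex.Im (alpha_p f y (half (~~ b) r1) ord0)) //.
    by under eq_fun do rewrite (E _).2; exact: cball_lin.
Qed.

Lemma measurable_alpha_p (D : set mR3) f : test_function f ->
  @measurable_fun _ _ mR3 mR D (fun y => vnorm (alpha_p f y)).
Proof.
move=> tf; apply: measurable_vnorm => k; have [[cr _] [ci _]] := alpha_p_cball k tf.
by split; apply: measurable_funTS; exact: continuous3_measurable.
Qed.

(** The factor [3] counts the pairings [Lj] in each line of [dirac_spinor_pair]; each of them is at
    most [Z], since a real component is bounded by [vnorm]. *)
Lemma dirac_bound (f : R * R * R -> 'cV[R[i]]_4) e x k : 0 < e -> test_function f ->
  let Z := (\int[mu3]_(y in @ball1 R) (Hker e x y * vnorm (alpha_p f y))%:E)%E in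
  (`|\int[mu3]_y (rho e x y * re_comp f k y)|%:E <= 3%:E * Z)%E /\
  (`|\int[mu3]_y (rho e x y * im_comp f k y)|%:E <= 3%:E * Z)%E.
Proof.
move=> e0 tf Z; have [b [r ->]] := halfP k.
have C1 l := test_function_C1ball l tf.
have mN := measurable_alpha_p (D := @ball1 R) tf.
have Lr j l : (`|Lj e x j (re_comp (alpha_p f) l)|%:E <= Z)%E.
  apply: Lj_le => //; first by have [] := alpha_p_cball l tf.
  by move=> y; have [] := normr_comp_le (alpha_p f y) l.
have Li j l : (`|Lj e x j (im_comp (alpha_p f) l)|%:E <= Z)%E.
  apply: Lj_le => //; first by have [] := alpha_p_cball l tf.
  by move=> y; have [] := normr_comp_le (alpha_p f y) l.
pose a0 := re_comp f (half b r0); pose b0 := im_comp f (half b r0).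
pose a1 := re_comp f (half b r1); pose b1 := im_comp f (half b r1).
have E y := alpha_pE f b y.
have EP0 : (fun y => 1 * partial j3 b0 y + 1 * partial j1 b1 y + (-1) * partial j2 a1 y)
    = re_comp (alpha_p f) (half (~~ b) r0).
  by apply/funext => y; rewrite /re_comp (E y).1.
have EQ0 : (fun y => (-1) * partial j3 a0 y + (-1) * partial j1 a1 y + (-1) * partial j2 b1 y)
    = im_comp (alpha_p f) (half (~~ b) r0).
  by apply/funext => y; rewrite /im_comp (E y).1.
have EP1 : (fun y => 1 * partial j1 b0 y + 1 * partial j2 a0 y + (-1) * partial j3 b1 y)
    = re_comp (alpha_p f) (half (~~ b) r1).
  by apply/funext => y; rewrite /re_comp (E y).2.
have EQ1 : (fun y => (-1) * partial j1 a0 y + 1 * partial j2 b0 y + 1 * partial j3 a1 y)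
    = im_comp (alpha_p f) (half (~~ b) r1).
  by apply/funext => y; rewrite /im_comp (E y).2.
have := dirac_spinor_pair x e0 (C1 (half b r0)).1 (C1 (half b r0)).2 (C1 (half b r1)).1 (C1 (half b r1)).2.
cbv zeta; rewrite EP0 EQ0 EP1 EQ1 {EP0 EQ0 EP1 EQ1 E}.
(* Covers [Z = +oo] as well, so that no finiteness has to be established at this point. *)
have tri (a c d s : R) : (`|a|%:E <= Z)%E -> (`|c|%:E <= Z)%E -> (`|d|%:E <= Z)%E ->
    `|s| <= `|a| + `|c| + `|d| -> (`|s|%:E <= 3%:E * Z)%E.
  case: Z {Lr Li} => [z| |]; rewrite ?lee_fin; first by move=> *; lra.
    by move=> _ _ _ _; rewrite gt0_muley ?lte_fin// leey.
  by [].
have n3 (a c d : R) : `|a + c + d| <= `|a| + `|c| + `|d|.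
  by rewrite (le_trans (ler_normD _ _))// lerD2r ler_normD.
have nN (a c d : R) : (`|a + c - d| <= `|a| + `|c| + `|d|) *
  (`|- a - c - d| <= `|a| + `|c| + `|d|) * (`|a - c + d| <= `|a| + `|c| + `|d|)
  * (`|- a + c + d| <= `|a| + `|c| + `|d|).
  by do !split; rewrite (le_trans (n3 _ _ _))// ?normrN.
move=> [I1 I2 I3 I4].
case: r => -[|[|//]] lr.
- have -> : half b (Ordinal lr) = half b r0 by congr half; exact: val_inj.
  by rewrite I1 I2; split; [apply: tri (nN _ _ _).1.1.1|apply: tri (nN _ _ _).1.1.2].
- have -> : half b (Ordinal lr) = half b r1 by congr half; exact: val_inj.
  by rewrite I3 I4; split; [apply: tri (nN _ _ _).1.2|apply: tri (nN _ _ _).2].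
Qed.

End dirac.

(** * Approximate identity *)

Section rescaling.

(** A change of variables with constant Jacobian [c], tested on nonnegative measurable functions
    with values in the extended reals, so that Tonelli carries it over to products. *)
Definition rescales d (T : measurableType d) (R : realType) (m : set T -> \bar R)
    (phi : T -> T) (c : R) :=
  [/\ measurable_fun setT phi, 0 <= c &
    forall F : T -> \bar R, measurable_fun setT F -> (forall x, 0 <= F x)%E ->
      (\int[m]_x F x = c%:E * \int[m]_x F (phi x))%E].

Lemma rescales_sprod d1 d2 (T1 : measurableType d1) (T2 : measurableType d2) (R : realType)
    (m1 : {sigma_finite_measure set T1 -> \bar R})
    (m2 : {sigma_finite_measure set T2 -> \bar R}) phi1 c1 phi2 c2 :
  rescales m1 phi1 c1 -> rescales m2 phi2 c2 ->
  rescales (sprod m1 m2) (fun x => (phi1 x.1, phi2 x.2)) (c1 * c2).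
Proof.
move=> [mp1 c10 E1] [mp2 c20 E2]; split.
- by apply/measurable_fun_pairP; split; [exact: measurableT_comp mp1 _|exact: measurableT_comp mp2 _].
- exact: mulr_ge0.
move=> F mF F0.
have mG : measurable_fun setT (fun x : T1 * T2 => F (x.1, phi2 x.2)).
  apply: measurableT_comp => //; apply/measurable_fun_pairP; split.
    exact: measurable_fst.
  exact: measurableT_comp mp2 _.
have mH : measurable_fun setT (fun x : T1 * T2 => F (phi1 x.1, phi2 x.2)).
  apply: measurableT_comp => //; apply/measurable_fun_pairP.
  by split; [exact: measurableT_comp mp1 _|exact: measurableT_comp mp2 _].
rewrite (@fubini_tonelli1 _ _ _ _ _ m1 m2 F)// [in RHS](@fubini_tonelli1 _ _ _ _ _ m1 m2)//.
rewrite /fubini_F.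
have mx x : measurable_fun setT (fun y => F (x, y)).
  by apply: measurableT_comp => //; exact: measurable_pair1.
under eq_integral do rewrite E2//.
have mI := @measurable_fun_fubini_tonelli_F _ _ _ _ _ m2 _ mG (fun=> F0 _).
rewrite ge0_integralZl//; last by move=> x _; exact: integral_ge0.
rewrite (E1 (fubini_F m2 (fun x => F (x.1, phi2 x.2))))//; last by move=> x; exact: integral_ge0.
by rewrite EFinM muleCA muleA.
Qed.

Variable R : realType.
Notation mR := (measurableTypeR R).
Notation mR3 := (mR * mR * mR)%type.
Notation mu := (@lebesgue_measure R).
Notation mu3 := (@lebesgue3 R).
Notation mu2 := (sprod mu mu).

Lemma rescales_affine (a e : R) : 0 < e -> rescales mu (fun t => a + e * t) e.
Proof.
move=> e0; pose phi : mR -> mR := fun t => a + e * t; rewrite -/phi.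
have mphi : @measurable_fun _ _ mR mR setT phi.
  by apply: continuous_measurable_fun => t; apply: cvgD; [exact: cvg_cst|apply: cvgM; [exact: cvg_cst|exact: cvg_id]].
split => //; first exact: ltW.
move=> F mF F0.
pose k : {nonneg R} := NngNum (ltW e0).
have [m mE0] : exists m : {measure set mR -> \bar R}, m = pushforward mu phi :> (set mR -> \bar R).
  by unshelve eexists (pushforward mu phi : {measure set mR -> \bar R}).
(* Lebesgue measure is determined by its values on half-open intervals, and the preimage of []c, d]]
   has length [(d - c) / e]. *)
have mE A : measurable A -> mu A = mscale k m A.
  apply: lebesgue_measure_unique => //= _ [[c d]] _ <-; rewrite /mscale/= mE0.
  rewrite /mscale/= /pushforward.
  have -> : phi @^-1` `]c, d]%classic = `](c - a) / e, (d - a) / e]%classic.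
    apply/seteqP; split => t /=; rewrite !in_itv/= /phi => /andP[h1 h2]; apply/andP.
      by rewrite ltr_pdivrMr// ler_pdivlMr//; split; lra.
    by move: h1 h2; rewrite ltr_pdivrMr// ler_pdivlMr// => h1 h2; split; lra.
  rewrite !lebesgue_measure_itv/= !lte_fin ltr_pM2r ?invr_gt0// ltrD2r.
  case: ifPn => _; last by rewrite mule0.
  rewrite -!EFinB -EFinM; congr EFin; field.
  exact: lt0r_neq0.
rewrite (eq_measure_integral (mscale k m))//=; last by move=> A mA _; exact: mE.
rewrite ge0_integral_mscale//=; congr (_ * _)%E.
by rewrite mE0 ge0_integral_pushforward.
Qed.

Definition affine3 (x : R * R * R) (e : R) (z : R * R * R) : R * R * R :=
  (x.1.1 + e * z.1.1, x.1.2 + e * z.1.2, x.2 + e * z.2).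

Lemma rescales3 x e : 0 < e -> rescales mu3 (affine3 x e) (e ^+ 3).
Proof.
move=> e0; rewrite exprSr expr2.
exact: (rescales_sprod (rescales_sprod (rescales_affine _ e0) (rescales_affine _ e0)) (rescales_affine _ e0)).
Qed.

(** Tonelli removes the last coordinate, at the cost of one factor [M]; this is done twice. *)
Lemma integral_prod3_le (g : R -> R) (M : R) : measurable_fun setT g -> (forall t, 0 <= g t) ->
  (\int[mu]_t (g t)%:E <= M%:E)%E ->
  (\int[mu3]_z (g z.1.1 * g z.1.2 * g z.2)%:E <= (M ^+ 3)%:E)%E.
Proof.
move=> mg g0 gM.
have M0 : 0 <= M by rewrite -lee_fin (le_trans _ gM)// integral_ge0// => t _; rewrite lee_fin.
have mgE : measurable_fun setT (EFin \o g) by exact/measurable_EFinP.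
have fprod d (T : measurableType d) (m : {sigma_finite_measure set T -> \bar R}) (f : T -> R) N :
   measurable_fun setT f -> (forall t, 0 <= f t) -> (\int[m]_t (f t)%:E <= N%:E)%E ->
   (\int[sprod m mu]_z (f z.1 * g z.2)%:E <= (N * M)%:E)%E.
  move=> mf f0 fN.
  have mfE : measurable_fun setT (EFin \o f) by exact/measurable_EFinP.
  rewrite (@fubini_tonelli1 _ _ _ _ _ m mu) /fubini_F/=; last 2 first.
  - by apply/measurable_EFinP; apply: measurable_funM; apply: measurableT_comp.
  - by move=> z; rewrite lee_fin mulr_ge0.
  under eq_integral do under eq_integral do rewrite EFinM.
  under eq_integral => t _.
    rewrite ge0_integralZl//; last first.
    - by rewrite lee_fin.
    - by move=> s _; rewrite lee_fin.
    over.
  rewrite ge0_integralZr//; last first.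
  - by apply: integral_ge0 => s _; rewrite lee_fin.
  - by move=> s _; rewrite lee_fin.
  by rewrite EFinM lee_pmul//; apply: integral_ge0 => s _; rewrite lee_fin.
rewrite exprSr expr2.
apply: (fprod _ _ mu2 (fun z => g z.1 * g z.2)); last exact: fprod.
- by apply: measurable_funM; apply: measurableT_comp.
- by move=> z; rewrite mulr_ge0.
Qed.

End rescaling.

(** * One-dimensional integrals for the separable majorants *)

Section one_dim.
Variable R : realType.
Notation mR := (measurableTypeR R).
Notation mu := (@lebesgue_measure R).

Lemma integral_even_le (g : R -> R) : measurable_fun setT g -> (forall t, 0 <= g t) ->
  (forall t, g (- t) = g t) ->
  (\int[mu]_t (g t)%:E <= 2%:E * \int[mu]_(t in `[0%R, +oo[) (g t)%:E)%E.
Proof.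
move=> mg g0 gN.
have mgE : measurable_fun setT (EFin \o g) by exact/measurable_EFinP.
have gE0 t : (0 <= (g t)%:E)%E by rewrite lee_fin.
have -> : (\int[mu]_t (g t)%:E = \int[mu]_(t in `]-oo, 0%R] `|` `]0%R, +oo[) (g t)%:E)%E.
  congr (integral _ _ _); apply/seteqP; split => // t _ /=; rewrite !in_itv/= andbT.
  by apply/orP; case: leP.
rewrite ge0_integral_setU//=; first last.
- rewrite disj_set2E; apply/eqP/seteqP; split => // t [] /=.
  by rewrite !in_itv/= andbT => /le_lt_trans h /h; rewrite ltxx.
- exact: measurable_funTS.
have -> : (\int[mu]_(t in `]-oo, 0%R]) (g t)%:E = \int[mu]_(t in `[0%R, +oo[) (g t)%:E)%E.
  rewrite ge0_integration_by_substitution0//; apply: eq_integral => t _.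
  by rewrite gN.
rewrite mule_natl mule2n leeD2l//; apply: ge0_subset_integral => //.
  exact: measurable_funTS.
by move=> t /=; rewrite !in_itv/= !andbT => /ltW.
Qed.

(** From [(t + e)^2 <= 2 (t^2 + e^2)]. The right-hand side has an elementary primitive in [t]. *)
Lemma sqr_powR_le (b t e : R) : 0 <= b -> 0 <= t -> 0 < e ->
  (t ^+ 2 + e ^+ 2) `^ (- b) <= 2 `^ b * (t + e) `^ (- (2 * b)).
Proof.
move=> b0 t0 e0.
have te : 0 < t + e by lra.
have q0 : 0 < t ^+ 2 + e ^+ 2 by rewrite ltr_wpDl ?sqr_ge0// exprn_gt0.
rewrite !powRN (powRrM _ 2 b) (powR_mulrn 2)//; last exact: ltW.
rewrite -[leLHS]mul1r ler_pdivrMr ?powR_gt0// mulrAC ler_pdivlMr ?mul1r ?powR_gt0 ?exprn_gt0//.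
rewrite -powRM//; last exact: ltW.
apply: ge0_ler_powR => //; rewrite ?nnegrE ?sqr_ge0//.
  by rewrite mulr_ge0// ltW.
have := sqr_ge0 (t - e); nra.
Qed.

Lemma is_derive_shift_powR (c a t : R) : 0 < t + c -> a != 0 ->
  is_derive t (1:R) (fun s => (s + c) `^ a / a) ((t + c) `^ (a - 1)).
Proof.
move=> tc a0.
have d1 : is_derive t (1:R) (fun s => s + c) 1.
  by apply: is_derive_eq; rewrite addr0.
have d2 := @is_derive1_comp _ (fun z => z `^ a) (fun s => s + c) t _ _ (is_derive1_powR a tc) d1.
have -> : (fun s => (s + c) `^ a / a) = a^-1 \*: ((fun z => z `^ a) \o (fun s => s + c)).
  by apply/funext => s /=; rewrite mulrC.
apply: is_derive_eq; rewrite /GRing.scale/= mulr1 mulrA mulVf ?mul1r//.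
Qed.

Lemma continuous_shift_powR (c a t : R) : 0 < t + c -> {for t, continuous (fun s => (s + c) `^ a)}.
Proof.
move=> tc; apply: (@continuous_comp _ _ _ (fun s => s + c) (fun z => z `^ a)).
  by apply: cvgD; [exact: cvg_id|exact: cvg_cst].
apply: differentiable_continuous; apply/derivable1_diffP.
by case: (is_derive1_powR a tc).
Qed.

Lemma shift_powRN_cvgy (c a : R) : 0 <= c -> 0 < a -> (x + c) `^ (- a) @[x --> +oo] --> (0 : R).
Proof.
move=> c0 a0; apply/cvgrPdist_le => /= d d0; near=> x.
have x0 : 0 < x + c by rewrite ltr_wpDr//; near: x; exact: nbhs_pinfty_gt.
rewrite sub0r normrN ger0_norm ?powR_ge0// powRN -[d]invrK lef_pV2 ?posrE ?invr_gt0 ?powR_gt0//.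
have -> : d^-1 = ((d^-1) `^ a^-1) `^ a.
  by rewrite -powRrM mulVf ?gt_eqF// powRr1// invr_ge0 ltW.
apply: ge0_ler_powR; rewrite ?nnegrE ?powR_ge0 ?(ltW x0) ?(ltW a0)//.
rewrite ler_wpDr//; near: x; exact: nbhs_pinfty_ge.
Unshelve. all: by end_near. Qed.

(** The exponent [5/6] is a third of the exponent [5/2] of [rho]. It gives decay of order [5/3 > 1]
    at infinity, and [F] is the primitive of [(t + 1)^(-5/3)]. *)
Lemma integral_tail_fin : exists2 M : R, 0 <= M &
  (\int[mu]_t ((t ^+ 2 + 1 ^+ 2) `^ (- (5 / 6)))%:E <= M%:E)%E.
Proof.
have a0 : - (2 / 3) != 0 :> R by rewrite lt_eqF//; lra.
pose F (s : R) := (s + 1) `^ (- (2 / 3)) / (- (2 / 3)).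
pose f (s : R) := (s + 1) `^ (- (2 / 3) - 1).
have dF (t : R) : 0 <= t -> is_derive t (1:R) F (f t).
  by move=> t0; apply: is_derive_shift_powR => //; lra.
have cF (t : R) : 0 <= t -> {for t, continuous F}.
  by move=> t0; apply: differentiable_continuous; apply/derivable1_diffP; case: (dF t t0).
have cg : continuous (fun t : R => (t ^+ 2 + 1 ^+ 2) `^ (- (5 / 6))).
  apply: continuous_comp_powR => [t|t]; first by rewrite ltr_wpDl ?sqr_ge0// expr1n.
  by apply: cvgD; [exact: exprn_continuous|exact: cvg_cst].
have cf : {in `[0, +oo[, continuous f}.
  move=> t; rewrite in_itv/= andbT => t0; by apply: (@continuous_shift_powR 1); rewrite ltr_wpDl.
have I : (\int[mu]_(t in `[0%R, +oo[) (f t)%:E = 0%:E - (F 0)%:E)%E.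
  apply: ge0_continuous_FTC2y => //.
  - by move=> t t0; exact: powR_ge0.
  - apply: continuous_in_subspaceT => t; rewrite inE => t0; exact: cf.
  - rewrite -[X in _ --> X](mul0r (- (2/3))^-1); apply: cvgM; last exact: cvg_cst.
    by have := @shift_powRN_cvgy 1 (2 / 3); apply; [exact: ler01|lra].
  - by move=> t t0; case: (dF t (ltW t0)).
  - by apply: cvg_at_right_filter; exact: cF.
  - by move=> t; rewrite in_itv/= andbT => t0; rewrite derive1E; apply: derive_val; exact: dF (ltW t0).
have F0 : F 0 <= 0 by rewrite /F mulr_ge0_le0 ?powR_ge0// invr_le0; lra.
have b0 : 0 <= 2 * (2 `^ (5 / 6) * - F 0) by rewrite !mulr_ge0 ?powR_ge0// oppr_ge0.
exists (2 * (2 `^ (5 / 6) * - F 0)) => //.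
apply: (le_trans (integral_even_le _ _ _)).
- exact: continuous_measurable_fun.
- by move=> t; exact: powR_ge0.
- by move=> t; rewrite sqrrN.
rewrite EFinM lee_pmul2l ?lte_fin//.
have -> : (2 `^ (5 / 6) * - F 0)%:E = (\int[mu]_(t in `[0%R, +oo[) ((2 `^ (5 / 6))%:E * (f t)%:E))%E.
  rewrite ge0_integralZl//.
  - by rewrite I -EFinB sub0r.
  - apply/measurable_EFinP; apply: subspace_continuous_measurable_fun => //.
    by apply: continuous_in_subspaceT => t; rewrite inE => t0; exact: cf.
  - by move=> t _; rewrite lee_fin powR_ge0.
apply: ge0_le_integral => //.
- by move=> t _; rewrite lee_fin powR_ge0.
- by apply/measurable_EFinP; apply: measurable_funTS; exact: continuous_measurable_fun.
- apply/measurable_EFinP; apply: measurable_funM => //.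
  apply: subspace_continuous_measurable_fun => //.
  by apply: continuous_in_subspaceT => t; rewrite inE => t0; exact: cf.
- move=> t /=; rewrite in_itv/= andbT => t0; rewrite -EFinM lee_fin.
  have b0' : 0 <= 5 / 6 :> R by lra.
  apply: (le_trans (sqr_powR_le b0' t0 ltr01)).
  by rewrite /f (_ : - (2 * (5 / 6)) = - (2 / 3) - 1) ?lexx//; lra.
Qed.

(** The cut at [2] is invisible for the difference of coordinates of two points of the unit ball,
    and it makes the integral over the line finite, uniformly in [e]. *)
Definition trunc_sing (b e : R) : R -> R := (fun t => (t ^+ 2 + e ^+ 2) `^ (- b)) \_ `[-2, 2].

Lemma trunc_sing_ge0 b e t : 0 <= trunc_sing b e t.
Proof. by rewrite /trunc_sing patchE; case: ifP => // _; exact: powR_ge0. Qed.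

Lemma continuous_sing b e : 0 < e -> continuous (fun t : R => (t ^+ 2 + e ^+ 2) `^ (- b)).
Proof.
move=> e0; apply: continuous_comp_powR => [t|t]; first by rewrite ltr_wpDl ?sqr_ge0// exprn_gt0.
by apply: cvgD; [exact: exprn_continuous|exact: cvg_cst].
Qed.

Lemma measurable_trunc_sing b e : 0 < e -> measurable_fun setT (trunc_sing b e : mR -> mR).
Proof.
move=> e0; apply/(measurable_restrictT _ _).1 => //.
by apply: measurable_funTS; apply: continuous_measurable_fun; exact: continuous_sing.
Qed.

Lemma integral_trunc_sing_le (b : R) : 0 <= b -> 2 * b < 1 -> exists2 M : R, 0 <= M &
  forall e, 0 < e <= 1 -> (\int[mu]_t (trunc_sing b e t)%:E <= M%:E)%E.
Proof.
move=> b0 b1; pose g := 1 - 2 * b.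
have g0 : 0 < g by rewrite /g; lra.
have M0 : 0 <= 2 * (2 `^ b * (3 `^ g / g)) by rewrite !mulr_ge0 ?powR_ge0 ?invr_ge0// ltW.
(* The factor [2] comes from evenness, [2^b] from [sqr_powR_le], and [3^g / g] bounds the primitive
   [(t + e)^g / g] at [t = 2], as [e <= 1]. *)
exists (2 * (2 `^ b * (3 `^ g / g))) => // e /andP[e0 e1].
have mt := measurable_trunc_sing b e0.
apply: (le_trans (integral_even_le _ _ _)) => //.
- exact: trunc_sing_ge0.
- move=> t; rewrite /trunc_sing !patchE sqrrN; congr (if _ then _ else _).
  by apply/idP/idP; rewrite !inE/= !in_itv/= => /andP[? ?]; apply/andP; split; lra.
rewrite EFinM lee_pmul2l ?lte_fin//.
pose F (s : R) := (s + e) `^ g / g.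
pose f (s : R) := (s + e) `^ (g - 1).
have dF (t : R) : 0 <= t -> is_derive t (1:R) F (f t).
  by move=> t0; apply: is_derive_shift_powR => //; [lra|exact: lt0r_neq0].
have cF (t : R) : 0 <= t -> {for t, continuous F}.
  by move=> t0; apply: differentiable_continuous; apply/derivable1_diffP; case: (dF t t0).
have cf : {within `[0, 2], continuous f}.
  apply: continuous_in_subspaceT => t; rewrite inE/= in_itv/= => /andP[t0 _].
  by apply: (@continuous_shift_powR e); rewrite ltr_wpDl.
have I : (\int[mu]_(t in `[0%R, 2%R]) (f t)%:E = (F 2)%:E - (F 0)%:E)%E.
  apply: continuous_FTC2 => //.
  - split.
    + by move=> t; rewrite in_itv/= => /andP[t0 _]; case: (dF t (ltW t0)).
    + by apply: cvg_at_right_filter; exact: cF.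
    + by apply: cvg_at_left_filter; apply: cF.
  - by move=> t; rewrite in_itv/= => /andP[t0 _]; rewrite derive1E; apply: derive_val; exact: dF (ltW t0).
have -> : (\int[mu]_(t in `[0%R, +oo[) (trunc_sing b e t)%:E =
    \int[mu]_(t in `[0%R, 2%R]) ((t ^+ 2 + e ^+ 2) `^ (- b))%:E)%E.
  rewrite integral_mkcond [RHS]integral_mkcond; apply: eq_integral => t _.
  rewrite /trunc_sing !patchE; case: ifPn => [|]; rewrite ?notin_setE ?inE/= !in_itv/= ?andbT => t0.
    case: ifPn; rewrite ?notin_setE ?inE/= !in_itv/= => t2.
      by rewrite ifT// inE/= in_itv/= t0; case/andP: t2.
    rewrite ifF//; apply/negP; rewrite inE/= in_itv/= => /andP[_ t3]; apply: t2.
    by rewrite t3 andbT (le_trans _ t0)//; lra.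
  by rewrite ifF//; apply/negP; rewrite inE/= in_itv/= => /andP[t3 _]; apply: t0.
apply: (@le_trans _ _ (\int[mu]_(t in `[0%R, 2%R]) ((2 `^ b)%:E * (f t)%:E))%E).
  apply: ge0_le_integral => //.
  - by move=> t _; rewrite lee_fin powR_ge0.
  - apply/measurable_EFinP; apply: measurable_funTS; apply: continuous_measurable_fun.
    exact: continuous_sing.
  - apply/measurable_EFinP; apply: measurable_funM => //.
    exact: subspace_continuous_measurable_fun.
  - move=> t /=; rewrite in_itv/= => /andP[t0 _]; rewrite -EFinM lee_fin.
    apply: (le_trans (sqr_powR_le b0 t0 e0)).
    by rewrite /f (_ : - (2 * b) = g - 1) ?lexx// /g; lra.
rewrite ge0_integralZl//.
- rewrite I -EFinB -EFinM lee_fin ler_wpM2l ?powR_ge0//.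
  rewrite lerBlDr ler_wpDr//; first by rewrite mulr_ge0 ?powR_ge0 ?invr_ge0// ltW.
  rewrite ler_wpM2r ?invr_ge0 ?(ltW g0)//.
  by apply: ge0_ler_powR; rewrite ?nnegrE ?(ltW g0)//; lra.
- by apply/measurable_EFinP; exact: subspace_continuous_measurable_fun.
- by move=> t _; rewrite lee_fin powR_ge0.
Qed.

End one_dim.

(** * Mass, scaling and convergence of [rho] *)

Section approximate_identity.
Variable R : realType.
Notation mR := (measurableTypeR R).
Notation mR3 := (mR * mR * mR)%type.
Notation mu3 := (@lebesgue3 R).
Notation rho1 := (@rho R 1 0).

Lemma rho_ge0 e (x y : R * R * R) : 0 <= rho e x y.
Proof. by apply: mulr_ge0; [apply: mulr_ge0 => //; exact: sqr_ge0|exact: powR_ge0]. Qed.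

Lemma dist2e_affine e (x z : R * R * R) : dist2e e x (affine3 x e z) = e ^+ 2 * dist2e 1 0 z.
Proof.
rewrite /dist2e !sum3 /coord /affine3 /=; ring.
Qed.

(** The powers cancel: [e^3] from the Jacobian, [e^2] from the factor in [rho], and
    [(e^2)^(-5/2) = e^(-5)]. *)
Lemma rho_affine e (x z : R * R * R) : 0 < e -> e ^+ 3 * rho e x (affine3 x e z) = rho1 z.
Proof.
move=> e0; rewrite /rho /kap dist2e_affine.
have d0 : 0 < dist2e 1 0 z by apply: dist2e_gt0.
rewrite powRM ?sqr_ge0 ?(ltW d0)// -(powR_mulrn 2 (ltW e0)) -powRrM.
rewrite (_ : 2 * (- (3 / 2) - 1) = - 5%:R); last by lra.
rewrite powR_invn ?(ltW e0)// powR_mulrn ?(ltW e0)//.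
by field; exact: lt0r_neq0.
Qed.

Lemma continuous_affine3 (x : R * R * R) e : continuous (affine3 x e).
Proof.
have c (a : R) (f : R * R * R -> R) : continuous f -> continuous (fun z => a + e * f z).
  move=> cf z; apply: cvgD; first exact: cvg_cst.
  by apply: cvgM; [exact: cvg_cst|exact: cf].
have [c1 [c2 c3]] := @continuous_coord R.
by apply: continuous_pair; [apply: continuous_pair|]; exact: c.
Qed.

(** The geometric-mean device again: [q^(-5/2)] is split into three factors [q^(-5/6)], each bounded
    by a function of a single coordinate. *)
Lemma rho1_integrable : mu3.-integrable setT (EFin \o rho1).
Proof.
have mr : @measurable_fun _ _ mR3 mR setT rho1.
  by apply: continuous3_measurable; apply: continuous_rho.
apply/integrableP; split; first exact/measurable_EFinP.
have [M M0 IM] := @integral_tail_fin R.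
pose g (t : R) := (t ^+ 2 + 1 ^+ 2) `^ (- (5 / 6)).
have cg : continuous g.
  apply: continuous_comp_powR => [t|t]; first by rewrite ltr_wpDl ?sqr_ge0// expr1n.
  by apply: cvgD; [exact: exprn_continuous|exact: cvg_cst].
have mg : @measurable_fun _ _ mR mR setT g by exact: continuous_measurable_fun.
have g0 t : 0 <= g t by exact: powR_ge0.
have mG : @measurable_fun _ _ mR3 mR setT (fun z => g z.1.1 * g z.1.2 * g z.2).
  apply: continuous3_measurable => z.
  have [c1 [c2 c3]] := @continuous_coord R.
  apply: cvgM; last exact: (continuous_comp (c3 z) (cg _)).
  by apply: cvgM; [exact: (continuous_comp (c1 z) (cg _))|exact: (continuous_comp (c2 z) (cg _))].
have G0 (z : R * R * R) : 0 <= g z.1.1 * g z.1.2 * g z.2 by rewrite !mulr_ge0.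
apply: (@le_lt_trans _ _ (\int[mu3]_z (3%:E * (g z.1.1 * g z.1.2 * g z.2)%:E))%E).
  apply: ge0_le_integral => //.
  - by apply/measurable_EFinP; exact: measurableT_comp.
  - by apply/measurable_EFinP; apply: measurable_funM.
  move=> z _; rewrite -EFinM /= lee_fin ger0_norm ?rho_ge0//.
  have q0 (t : R) : 0 < t ^+ 2 + 1 ^+ 2 by rewrite ltr_wpDl ?sqr_ge0// expr1n.
  have d0 : 0 < dist2e 1 0 z by apply: dist2e_gt0.
  have qd (t : R) : t ^+ 2 + 1 ^+ 2 <= dist2e 1 0 z -> dist2e 1 0 z `^ (- (5 / 6)) <= g t.
    move=> td; rewrite /g !powRN lef_pV2 ?posrE ?powR_gt0//.
    by apply: ge0_ler_powR; [lra|rewrite nnegrE ltW..|].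
  rewrite /rho expr1n mulr1 ler_wpM2l// /kap.
  have -> : dist2e 1 0 z `^ (- (3 / 2) - 1) = dist2e 1 0 z `^ (- (5 / 6)) * dist2e 1 0 z `^ (- (5 / 6)) * dist2e 1 0 z `^ (- (5 / 6)).
    by rewrite -!powRD ?(gt_eqF d0) ?implybT//; congr (_ `^ _); lra.
  have E : dist2e 1 0 z = z.1.1 ^+ 2 + z.1.2 ^+ 2 + z.2 ^+ 2 + 1 ^+ 2.
    by rewrite /dist2e sum3 /coord /= !subr0.
  have := sqr_ge0 z.1.1; have := sqr_ge0 z.1.2; have := sqr_ge0 z.2 => h3 h2 h1.
  by rewrite !ler_pM ?mulr_ge0 ?powR_ge0// qd// E; lra.
rewrite ge0_integralZl//; [|by apply/measurable_EFinP; exact: mG|by move=> z _; rewrite lee_fin].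
apply: (@le_lt_trans _ _ (3%:E * (M ^+ 3)%:E)%E).
  by rewrite lee_pmul2l// integral_prod3_le.
by rewrite -EFinM ltry.
Qed.

(** The value is [4 pi]; its positivity allows dividing by it once the estimate is proved. *)
Definition crho : R := \int[mu3]_z rho1 z.

Lemma crho_gt0 : 0 < crho.
Proof.
have mr : @measurable_fun _ _ mR3 mR setT rho1.
  by apply: continuous3_measurable; apply: continuous_rho.
rewrite -lte_fin /crho /Rintegral fineK; last exact: integrable_fin_num rho1_integrable.
(* A lower bound of [rho1] on the box, where [dist2e 1 0] is at most [1 + 1 + 1 + 1]. *)
pose c : R := 3 * 4 `^ (- (3 / 2) - 1).
have c0 : 0 < c by rewrite mulr_gt0// powR_gt0.
have mb := @box3_measurable R.
apply: (@lt_le_trans _ _ (\int[mu3]_(z in @box3 R) c%:E)%E).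
  rewrite integral_cst// mule_gt0 ?lte_fin// lebesgue3E /box3 product_measure1E//=; last exact: measurableX.
  by rewrite product_measure1E//= !lebesgue_measure_itv11 -!EFinM lte_fin; lra.
apply: (@le_trans _ _ (\int[mu3]_(z in @box3 R) (rho1 z)%:E)%E); last first.
  apply: ge0_subset_integral => //; first exact/measurable_EFinP.
  by move=> z _; rewrite lee_fin rho_ge0.
apply: ge0_le_integral => //.
- by move=> z _; rewrite lee_fin ltW.
- by apply/measurable_EFinP; exact: measurable_funTS.
move=> [[x y] z] [[/= bx bY] bz]; rewrite lee_fin /c /rho expr1n mulr1 ler_wpM2l// /kap.
have d0 : 0 < dist2e 1 0 (x, y, z) by apply: dist2e_gt0.
rewrite (_ : - (3 / 2) - 1 = - (5 / 2)); last by lra.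
rewrite !powRN lef_pV2 ?posrE ?powR_gt0//; apply: ge0_ler_powR; [lra|by rewrite nnegrE ltW|by rewrite nnegrE|].
rewrite /dist2e sum3 /coord /= !subr0.
have s1 (t : R) : t \in `[-1, 1] -> t ^+ 2 <= 1 by rewrite in_itv/= => /andP[? ?]; nra.
by have := s1 _ bx; have := s1 _ bY; have := s1 _ bz; lra.
Qed.

Lemma integral_rho e x : 0 < e -> (\int[mu3]_y (rho e x y)%:E = crho%:E)%E.
Proof.
move=> e0; have [_ _ ->] := rescales3 x e0; last 2 first.
- by apply/measurable_EFinP; apply: continuous3_measurable; exact: continuous_rho.
- by move=> y; rewrite lee_fin rho_ge0.
rewrite -ge0_integralZl//; last 3 first.
- apply/measurable_EFinP; apply: continuous3_measurable => z.
  by apply: (continuous_comp (@continuous_affine3 x e z)); exact: continuous_rho.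
- by move=> z _; rewrite lee_fin rho_ge0.
- by rewrite lee_fin exprn_ge0// ltW.
rewrite /crho /Rintegral fineK; last exact: integrable_fin_num rho1_integrable.
by apply: eq_integral => z _; rewrite -EFinM rho_affine.
Qed.

(** Rescaling fixes the kernel at [rho1] and moves the parameter into the argument of [u]. Then
    [2 M rho1] dominates, and continuity of [u] at [x] gives the pointwise limit. *)
Lemma rho_cvg (u : R * R * R -> R) (x : R * R * R) : cball u ->
  \int[mu3]_y (rho n.+1%:R^-1 x y * u y) @[n --> \oo] --> crho * u x.
Proof.
move=> cu; have [M uM] := continuous_ball_bounded cu.1 cu.2.
pose en n : R := n.+1%:R^-1.
have en0 n : 0 < en n by rewrite /en invr_gt0.
have cD n : continuous (fun z => rho1 z * `|u (affine3 x (en n) z) - u x|).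
  move=> z; apply: cvgM; first exact: continuous_rho.
  apply: cvg_norm; apply: cvgB; last exact: cvg_cst.
  by apply: (continuous_comp (@continuous_affine3 x (en n) z)); exact: cu.1.
pose D n := (\int[mu3]_z (rho1 z * `|u (affine3 x (en n) z) - u x|)%:E)%E.
have D0 : D n @[n --> \oo] --> 0%E.
  rewrite -(@integral0 _ _ _ mu3 setT).
  apply: (@dominated_cvg _ _ _ mu3 setT _ _ _ (fun z => (rho1 z * (2 * M))%:E)) => //.
  - by move=> n; apply/measurable_EFinP; exact: continuous3_measurable.
  - move=> z _; apply: cvg_EFin; first by near=> n.
    rewrite -[X in _ --> X](mulr0 (rho1 z)); apply: cvgM; first exact: cvg_cst.
    rewrite (_ : 0 = `|u x - u x|); last by rewrite subrr normr0.
    apply: cvg_norm; apply: cvgB; last exact: cvg_cst.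
    have ca : continuous (fun e : R => affine3 x e z).
      have c (a b : R) : continuous (fun e : R => a + e * b).
        move=> e; apply: cvgD; first exact: cvg_cst.
        by apply: cvgM; [exact: cvg_id|exact: cvg_cst].
      by apply: continuous_pair; [apply: continuous_pair|]; exact: c.
    have ax : affine3 x 0 z = x by rewrite /affine3 !mul0r !addr0 -!surjective_pairing.
    apply: (@cvg_comp _ _ _ (fun n => affine3 x (en n) z) u _ (nbhs x)); last exact: cu.1.
    apply: (@cvg_comp _ _ _ en (fun e => affine3 x e z) _ (nbhs (0 : R))).
      exact: cvg_harmonic.
    by rewrite -{2}ax; exact: ca.
  - apply: (@eq_integrable _ _ _ mu3 setT measurableT (fun z => (2 * M)%:E * (rho1 z)%:E)%E).
      by move=> z _; rewrite -EFinM mulrC.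
    by apply: integrableZl => //; exact: rho1_integrable.
  - move=> n z _; rewrite lee_fin normrM normr_id ger0_norm ?rho_ge0// ler_wpM2l ?rho_ge0//.
    rewrite (le_trans (ler_normB _ _))// mulr_natl mulr2n lerD//.
have JD n : (`|\int[mu3]_y (rho (en n) x y * u y) - crho * u x|%:E <= D n)%E.
  have cru : cball (fun y => rho (en n) x y * u y).
    by apply: cball_mul => //; exact: continuous_rho.
  have irho : mu3.-integrable setT (EFin \o rho (en n) x).
    apply/integrableP; split.
      by apply/measurable_EFinP; apply: continuous3_measurable; exact: continuous_rho.
    under eq_integral do rewrite /= ger0_norm ?rho_ge0//.
    by rewrite integral_rho// ltry.
  have irhou : mu3.-integrable setT (EFin \o (fun y => u x * rho (en n) x y)).
    by rewrite [X in _.-integrable _ X](_ : _ = (fun y => (u x)%:E * (rho (en n) x y)%:E)%E)//; exact: integrableZl.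
  have -> : crho * u x = \int[mu3]_y (u x * rho (en n) x y).
    by rewrite RintegralZl// mulrC /Rintegral integral_rho.
  rewrite -RintegralB//; last exact: cball_integrable.
  rewrite EFin_normr_Rintegral//; last first.
    rewrite [X in _.-integrable _ X](_ : _ = (fun y => (rho (en n) x y * u y)%:E - (u x * rho (en n) x y)%:E)%E)//.
    by apply: integrableB => //; exact: (cball_integrable cru).
  have mK : @measurable_fun _ _ mR3 mR setT (fun y => rho (en n) x y * u y - u x * rho (en n) x y).
    apply: continuous3_measurable => y; apply: cvgB; first exact: cru.1.
    by apply: cvgM; [exact: cvg_cst|exact: continuous_rho].
  apply: (le_trans (le_abse_integral _ _ _)) => //; first exact/measurable_EFinP.
  have [_ _ ->] := rescales3 x (en0 n); last 2 first.
  - by apply/measurable_EFinP; exact: measurableT_comp.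
  - by move=> y; rewrite lee_fin.
  rewrite -ge0_integralZl//; last 2 first.
  - apply/measurable_EFinP; apply: measurableT_comp => //; apply: (measurableT_comp mK).
    by case: (rescales3 x (en0 n)).
  - by rewrite lee_fin exprn_ge0// ltW.
  rewrite /D le_eqVlt; apply/orP; left; apply/eqP; apply: eq_integral => z _.
  rewrite -EFinM; congr EFin.
  rewrite (mulrC (u x)) -mulrBr normrM (ger0_norm (rho_ge0 _ _ _)) mulrA.
  by rewrite rho_affine.
apply/cvgrPdist_lt => d d0.
have dE : (0 < d%:E :> \bar R)%E by rewrite lte_fin.
have /D0 : nbhs (0 : \bar R)%E [set y | (y < d%:E)%E].
  by apply: open_nbhs_nbhs; split; [exact: open_ereal_lt_ereal|].
move=> h; near=> n; rewrite distrC -lte_fin (le_lt_trans (JD n))//.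
by near: n; exact: h.
Unshelve. all: by end_near. Qed.

End approximate_identity.

(** * Young's inequality *)

Section holder.
Variable R : realType.

(** This is [ln t <= t - 1] at [t = a / m], the starting point of Polya's proof of the inequality
    between the means. *)
Lemma powR_le_expR (a th m : R) : 0 <= a -> 0 <= th -> 0 < m ->
  a `^ th <= m `^ th * expR (th * (a / m - 1)).
Proof.
move=> a0 th0 m0; have [->|thN0] := eqVneq th 0.
  by rewrite !powRr0 mul0r expR0 mulr1.
move: a0; rewrite le_eqVlt => /predU1P[<-|a0].
  by rewrite powR0// mulr_ge0 ?powR_ge0 ?expR_ge0.
have am : 0 < a / m by rewrite divr_gt0.
have -> : a `^ th = m `^ th * (a / m) `^ th.
  by rewrite -powRM ?(ltW m0) ?(ltW am)//; congr (_ `^ _); field; exact: lt0r_neq0.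
rewrite ler_wpM2l ?powR_ge0// /powR (gt_eqF am) ler_expR ler_wpM2l//.
have := @le_ln1Dx R (a / m - 1); rewrite (addrC 1) subrK; apply; lra.
Qed.

Lemma amgm3 (a b c t1 t2 t3 : R) : 0 <= a -> 0 <= b -> 0 <= c ->
  0 <= t1 -> 0 <= t2 -> 0 <= t3 -> t1 + t2 + t3 = 1 ->
  a `^ t1 * b `^ t2 * c `^ t3 <= t1 * a + t2 * b + t3 * c.
Proof.
move=> a0 b0 c0 t10 t20 t30 t1E.
set m := t1 * a + t2 * b + t3 * c.
have m1 : 0 <= t1 * a by exact: mulr_ge0.
have m2 : 0 <= t2 * b by exact: mulr_ge0.
have m3 : 0 <= t3 * c by exact: mulr_ge0.
(* If the mean vanishes, so does every [t_i] times its number; a nonzero weight exists since they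
   add up to [1], and its factor on the left is zero. Otherwise the exponents in [powR_le_expR] sum
   to zero when [m] is the weighted mean. *)
have [mE|mN0] := eqVneq m 0.
  have z (t s : R) : t * s = 0 -> t != 0 -> s `^ t = 0.
    by move=> /eqP; rewrite mulf_eq0 => /orP[/eqP-> /eqP|/eqP-> t0]//; rewrite powR0.
  have ea : t1 * a = 0 by rewrite /m in mE; lra.
  have eb : t2 * b = 0 by rewrite /m in mE; lra.
  have ec : t3 * c = 0 by rewrite /m in mE; lra.
  have [e1|/(z _ _ ea)->] := eqVneq t1 0; last by rewrite !mul0r mE.
  have [e2|/(z _ _ eb)->] := eqVneq t2 0; last by rewrite mulr0 mul0r mE.
  have [e3|/(z _ _ ec)->] := eqVneq t3 0; last by rewrite mulr0 mE.
  by move: t1E; rewrite e1 e2 e3 !addr0 => /esym/eqP; rewrite oner_eq0.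
have m0 : 0 < m by rewrite lt_neqAle eq_sym mN0 !addr_ge0.
have := powR_le_expR a0 t10 m0; have := powR_le_expR b0 t20 m0; have := powR_le_expR c0 t30 m0.
move=> hc hb ha.
apply: (@le_trans _ _ (m `^ t1 * expR (t1 * (a / m - 1)) * (m `^ t2 * expR (t2 * (b / m - 1))) * (m `^ t3 * expR (t3 * (c / m - 1))))).
  by rewrite !ler_pM ?mulr_ge0 ?powR_ge0.
have -> : m `^ t1 * expR (t1 * (a / m - 1)) * (m `^ t2 * expR (t2 * (b / m - 1))) * (m `^ t3 * expR (t3 * (c / m - 1)))
  = (m `^ t1 * m `^ t2 * m `^ t3) * (expR (t1 * (a / m - 1)) * expR (t2 * (b / m - 1)) * expR (t3 * (c / m - 1))) by ring.
rewrite -!expRD -!powRD ?mN0 ?implybT// t1E powRr1 ?(ltW m0)//.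
have -> : t1 * (a / m - 1) + t2 * (b / m - 1) + t3 * (c / m - 1) = 0.
  have -> : t1 * (a / m - 1) + t2 * (b / m - 1) + t3 * (c / m - 1) =
      (t1 * a + t2 * b + t3 * c) / m - (t1 + t2 + t3).
    by move: mN0; move: (m) => m' mN0; field.
  by rewrite -/m divff// t1E subrr.
by rewrite expR0 mulr1.
Qed.

(* Hölder's inequality for the splitting
   [H G = (H^r G^p)^(1/k) (H^r)^(1-1/p) (G^p)^(1/p-1/k)]. *)
Lemma holder3 d (T : measurableType d) (mu : {measure set T -> \bar R}) (D : set T)
    (H G : T -> R) (p k r A M N : R) :
  measurable D -> measurable_fun D H -> measurable_fun D G ->
  (forall y, 0 <= H y) -> (forall y, 0 <= G y) ->
  1 <= p -> p <= k -> 0 < r -> r^-1 = 1 + k^-1 - p^-1 ->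
  0 < A -> 0 < M -> 0 < N ->
  (\int[mu]_(y in D) (H y `^ r * G y `^ p)%:E <= A%:E)%E ->
  (\int[mu]_(y in D) (H y `^ r)%:E <= M%:E)%E ->
  (\int[mu]_(y in D) (G y `^ p)%:E <= N%:E)%E ->
  (\int[mu]_(y in D) (H y * G y)%:E <=
    (A `^ k^-1 * (M `^ (1 - p^-1) * N `^ (p^-1 - k^-1)))%:E)%E.
Proof.
move=> mD mH mG H0 G0 p1 pk r0 rE A0 M0 N0 IA IM IN.
have p0 : 0 < p by lra.
have k0 : 0 < k by lra.
set C := A `^ k^-1 * _.
have C0 : 0 <= C by rewrite !mulr_ge0 ?powR_ge0.
have t1 : 0 <= k^-1 by rewrite invr_ge0 ltW.
have t2 : 0 <= 1 - p^-1 by rewrite subr_ge0 invf_le1.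
have t3 : 0 <= p^-1 - k^-1 by rewrite subr_ge0 lef_pV2.
have mHr : measurable_fun D (fun y => H y `^ r) by exact: (measurableT_comp (measurable_powR _)).
have mGp : measurable_fun D (fun y => G y `^ p) by exact: (measurableT_comp (measurable_powR _)).
have mHG : measurable_fun D (fun y => H y `^ r * G y `^ p) by exact: measurable_funM.
(* Weighted means are taken of the three functions divided by the bounds [A], [M], [N] of their
   integrals. After integration each term is at most [C] times its weight, and the weights add up to
   [1]. *)
pose c1 := C * (k^-1 / A); pose c2 := C * ((1 - p^-1) / M); pose c3 := C * ((p^-1 - k^-1) / N).
have c10 : 0 <= c1 by rewrite mulr_ge0// divr_ge0// ltW.
have c20 : 0 <= c2 by rewrite mulr_ge0// divr_ge0// ltW.
have c30 : 0 <= c3 by rewrite mulr_ge0// divr_ge0// ltW.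
have pt y : H y * G y <= c1 * (H y `^ r * G y `^ p) + c2 * H y `^ r + c3 * G y `^ p.
  have S0 : 0 <= c1 * (H y `^ r * G y `^ p) + c2 * H y `^ r + c3 * G y `^ p.
    apply: addr_ge0; [apply: addr_ge0|]; apply: mulr_ge0 => //; rewrite ?powR_ge0//.
    by rewrite mulr_ge0 ?powR_ge0.
  have [HE|HN] := eqVneq (H y) 0; first by rewrite {1}HE mul0r.
  have [GE|GN] := eqVneq (G y) 0; first by rewrite {1}GE mulr0.
  have nn (x z : R) : 0 <= x -> 0 < z -> 0 <= x / z by move=> x0 z0; rewrite divr_ge0// ltW.
  have HG0 : 0 <= H y `^ r * G y `^ p by rewrite mulr_ge0 ?powR_ge0.
  have := amgm3 (nn _ _ HG0 A0) (nn _ _ (powR_ge0 (H y) r) M0) (nn _ _ (powR_ge0 (G y) p) N0) t1 t2 t3.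
  have dp (x z t : R) : 0 <= x -> 0 < z -> (x / z) `^ t = x `^ t / z `^ t.
    by move=> x0 z0; rewrite powRM ?invr_ge0 ?(ltW z0)// -powRN -powR_inv1 ?(ltW z0)// -powRrM mulN1r.
  rewrite !dp ?powR_ge0// powRM ?powR_ge0// -!powRrM.
  have -> : k^-1 + (1 - p^-1) + (p^-1 - k^-1) = 1 by ring.
  move=> /(_ erefl) h.
  (* The relation between [r], [p] and [k] is exactly what makes these exponents of [H] add up to
     [1]; those of [G] do so for any [k]. *)
  have EH : H y = H y `^ (r * k^-1) * H y `^ (r * (1 - p^-1)).
    rewrite -powRD ?HN ?implybT// -mulrDr (_ : k^-1 + (1 - p^-1) = r^-1); last by rewrite rE; ring.
    by rewrite mulfV ?powRr1// lt0r_neq0.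
  have EG : G y = G y `^ (p * k^-1) * G y `^ (p * (p^-1 - k^-1)).
    rewrite -powRD ?GN ?implybT// -mulrDr (_ : k^-1 + (p^-1 - k^-1) = p^-1); last by ring.
    by rewrite mulfV ?powRr1// lt0r_neq0.
  have hC : H y * G y = C * (H y `^ (r * k^-1) * G y `^ (p * k^-1) / A `^ k^-1 *
     (H y `^ (r * (1 - p^-1)) / M `^ (1 - p^-1)) *
     (G y `^ (p * (p^-1 - k^-1)) / N `^ (p^-1 - k^-1))).
    rewrite {1}EH {1}EG /C.
    have a0 := lt0r_neq0 (powR_gt0 k^-1 A0).
    have m0 := lt0r_neq0 (powR_gt0 (1 - p^-1) M0).
    have n0 := lt0r_neq0 (powR_gt0 (p^-1 - k^-1) N0).
    move: (A `^ k^-1) (M `^ (1 - p^-1)) (N `^ (p^-1 - k^-1)) a0 m0 n0 => a m n a0 m0 n0.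
    by field; rewrite a0 m0 n0.
  rewrite hC (le_trans (ler_wpM2l C0 h))// /c1 /c2 /c3 le_eqVlt; apply/orP; left; apply/eqP.
  ring.
apply: (@le_trans _ _ (\int[mu]_(y in D) (c1%:E * (H y `^ r * G y `^ p)%:E +
    c2%:E * (H y `^ r)%:E + c3%:E * (G y `^ p)%:E))%E).
  apply: ge0_le_integral => //.
  - by move=> y _; rewrite lee_fin mulr_ge0.
  - by apply/measurable_EFinP; exact: measurable_funM.
  - by apply: emeasurable_funD; [apply: emeasurable_funD|]; apply/measurable_EFinP; exact: measurable_funM.
  - by move=> y _; rewrite -!EFinM -!EFinD lee_fin; exact: pt.
have P0 (c x : R) : 0 <= c -> 0 <= x -> (0 <= c%:E * x%:E)%E by move=> *; rewrite -EFinM lee_fin mulr_ge0.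
have HG0 y : 0 <= H y `^ r * G y `^ p by rewrite mulr_ge0 ?powR_ge0.
have mE (c : R) (f : T -> R) : measurable_fun D f -> measurable_fun D (fun y => c%:E * (f y)%:E)%E.
  by move=> mf; apply/measurable_EFinP; exact: measurable_funM.
rewrite ge0_integralD//; last first.
- exact: mE.
- by move=> y _; rewrite P0 ?powR_ge0.
- by apply: emeasurable_funD; exact: mE.
- by move=> y _; rewrite adde_ge0 ?P0 ?powR_ge0.
rewrite ge0_integralD//; last first.
- exact: mE.
- by move=> y _; rewrite P0 ?powR_ge0.
- exact: mE.
- by move=> y _; rewrite P0.
rewrite !ge0_integralZl//; first last.
all: try exact/measurable_EFinP.
all: try by move=> y _; rewrite lee_fin ?powR_ge0 ?HG0.
have -> : C = c1 * A + c2 * M + c3 * N.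
  rewrite /c1 /c2 /c3; move: (C) => C'; field.
  by rewrite !lt0r_neq0.
rewrite !EFinD !EFinM !leeD// lee_pmul//; apply: integral_ge0 => y _; rewrite lee_fin ?powR_ge0//.
Qed.

End holder.

(** * Uniform integrability of the majorant, and the double integral in Young's inequality *)

Section young.
Variable R : realType.
Notation mR := (measurableTypeR R).
Notation mR3 := (mR * mR * mR)%type.
Notation mu := (@lebesgue_measure R).
Notation mu3 := (@lebesgue3 R).
Notation smu3 := (sprod (sprod mu mu) mu).

Lemma Hker_ge0 e (x y : R * R * R) : 0 <= Hker e x y.
Proof. by apply: prodr_ge0 => j _; exact: powR_ge0. Qed.

Lemma HkerC e (x y : R * R * R) : Hker e x y = Hker e y x.
Proof.
by apply: eq_bigr => j _; rewrite /hker -sqrrN opprB.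
Qed.

Lemma Hker_measurable2 e : 0 < e ->
  measurable_fun setT (fun z : mR3 * mR3 => Hker e z.1 z.2 : mR).
Proof.
move=> e0.
apply: measurable_prod => j _.
have mc : @measurable_fun _ _ mR3 mR setT (coord j).
  by apply: continuous3_measurable; exact: continuous_coordj.
have mh : @measurable_fun _ _ mR mR setT (fun t => (t ^+ 2 + e ^+ 2) `^ (- (1 / 3))).
  by apply: continuous_measurable_fun; exact: continuous_sing.
have md : measurable_fun setT (fun z : mR3 * mR3 => coord j z.2 - coord j z.1 : mR).
  by apply: measurable_funB; [exact: (measurableT_comp mc measurable_snd)|exact: (measurableT_comp mc measurable_fst)].
exact: (measurableT_comp mh md).
Qed.

Lemma Hker_measurable e (x : R * R * R) : 0 < e -> @measurable_fun _ _ mR3 mR setT (Hker e x).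
Proof.
move=> e0; exact: (measurableT_comp (Hker_measurable2 e0) (measurable_pair1 (x : mR3))).
Qed.

Lemma Hker_powR (r e : R) (x y : R * R * R) : 0 < e -> ball1 x -> ball1 y ->
  Hker e x y `^ r = trunc_sing (r / 3) e (y.1.1 - x.1.1) * trunc_sing (r / 3) e (y.1.2 - x.1.2)
                    * trunc_sing (r / 3) e (y.2 - x.2).
Proof.
move=> e0 /ball1_coord[x1 x2 x3] /ball1_coord[y1 y2 y3].
have T (a b : R) : `|a| < 1 -> `|b| < 1 ->
    trunc_sing (r / 3) e (b - a) = (((b - a) ^+ 2 + e ^+ 2) `^ (- (1 / 3))) `^ r.
  rewrite !ltr_norml => /andP[? ?] /andP[? ?].
  rewrite /trunc_sing patchE ifT; last by rewrite inE/= in_itv/=; apply/andP; split; lra.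
  by rewrite -powRrM; congr (_ `^ _); lra.
rewrite (T _ _ x1 y1) (T _ _ x2 y2) (T _ _ x3 y3).
have -> : Hker e x y = hker e x ord0 y * hker e x (lift ord0 ord0) y * hker e x (lift ord0 (lift ord0 ord0)) y.
  by rewrite /Hker !big_ord_recl big_ord0 mulr1 mulrA.
by rewrite powRM ?mulr_ge0 ?powR_ge0// powRM ?powR_ge0.
Qed.

(* The exponent [r < 3/2] of Young's inequality is written [3 * b]. *)
Lemma integral_Hker_le (b : R) : 0 <= b -> 2 * b < 1 -> exists2 M : R, 0 < M &
  forall (e : R) (x : R * R * R), 0 < e <= 1 -> ball1 x ->
  (\int[mu3]_(y in @ball1 R) (Hker e x y `^ (3 * b))%:E <= M%:E)%E.
Proof.
move=> b0 b1; have [M M0 HM] := integral_trunc_sing_le b0 b1.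
exists (M ^+ 3 + 1); first by rewrite ltr_wpDl ?exprn_ge0.
move=> e x e01 bx; have e0 : 0 < e by case/andP: e01.
pose g := trunc_sing b e.
have mg : @measurable_fun _ _ mR mR setT g by exact: measurable_trunc_sing.
have g0 t : 0 <= g t by exact: trunc_sing_ge0.
pose P (y : R * R * R) := g (y.1.1 - x.1.1) * g (y.1.2 - x.1.2) * g (y.2 - x.2).
have P0 y : 0 <= P y by rewrite /P !mulr_ge0.
have mP : @measurable_fun _ _ mR3 mR setT P.
  have m1 (a : R) (j : 'I_3) : @measurable_fun _ _ mR3 mR setT (fun y => g (coord j y - a)).
    apply: (measurableT_comp mg); apply: measurable_funB => //.
    by apply: continuous3_measurable; exact: continuous_coordj.
  apply: measurable_funM; [apply: measurable_funM|].
  - exact: (m1 x.1.1 (@ord0 2)).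
  - exact: (m1 x.1.2 (lift ord0 (@ord0 1))).
  - exact: (m1 x.2 (lift ord0 (lift ord0 (@ord0 0)))).
apply: (@le_trans _ _ (\int[mu3]_(y in @ball1 R) (P y)%:E)%E).
  rewrite le_eqVlt; apply/orP; left; apply/eqP; apply: eq_integral => y; rewrite inE => yB.
  by rewrite Hker_powR// /P /g; have -> : 3 * b / 3 = b by lra.
apply: (@le_trans _ _ (\int[mu3]_y (P y)%:E)%E).
  apply: ge0_subset_integral => //; first exact: ball1_measurable.
  - exact/measurable_EFinP.
  - by move=> y _; rewrite lee_fin.
have [_ _ ->] := rescales3 x ltr01; last 2 first.
- exact/measurable_EFinP.
- by move=> y; rewrite lee_fin.
rewrite expr1n mul1e.
apply: (@le_trans _ _ (M ^+ 3)%:E); last by rewrite lee_fin lerDl.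
apply: le_trans (integral_prod3_le mg g0 (HM _ e01)).
rewrite le_eqVlt; apply/orP; left; apply/eqP; apply: eq_integral => z _.
by rewrite /P /affine3 /= !mul1r !(addrC x.1.1) !(addrC x.1.2) !(addrC x.2) !addrK.
Qed.

(** After exchanging the integrals, the inner one runs over the first argument of [Hker]; by [HkerC]
    it is again at most [M], and the integral of [G^p] remains. *)
Lemma young_integral (b p e M N : R) (G : R * R * R -> R) :
  0 < e <= 1 -> @measurable_fun _ _ mR3 mR setT G -> (forall y, 0 <= G y) ->
  (forall (x : R * R * R), ball1 x ->
    (\int[mu3]_(y in @ball1 R) (Hker e x y `^ (3 * b))%:E <= M%:E)%E) ->
  (\int[mu3]_(y in @ball1 R) (G y `^ p)%:E <= N%:E)%E ->
  @measurable_fun _ _ mR3 _ (@ball1 R)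
    (fun x => \int[mu3]_(y in @ball1 R) (Hker e x y `^ (3 * b) * G y `^ p)%:E)%E /\
  (\int[mu3]_(x in @ball1 R) \int[mu3]_(y in @ball1 R) (Hker e x y `^ (3 * b) * G y `^ p)%:E
    <= (M * N)%:E)%E.
Proof.
move=> /andP[e0 e1] mG G0 HM GN.
have mB := @ball1_measurable R.
have M0 : 0 <= M.
  rewrite -lee_fin; apply: le_trans (HM 0 _); last by rewrite /ball1/= expr0n !addr0.
  by apply: integral_ge0 => y _; rewrite lee_fin powR_ge0.
(* Both restrictions to the ball become indicators, so that Tonelli applies on the whole product
   space. *)
pose W (z : mR3 * mR3) : \bar R :=
  (\1_(@ball1 R) z.1 * \1_(@ball1 R) z.2 * (Hker e z.1 z.2 `^ (3 * b) * G z.2 `^ p))%:E.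
have W0 z : (0 <= W z)%E by rewrite lee_fin !mulr_ge0 ?powR_ge0.
have m1 : @measurable_fun _ _ mR3 mR setT (\1_(@ball1 R)) by exact: measurable_indic.
have mGp : @measurable_fun _ _ mR3 mR setT (fun y => G y `^ p).
  exact: (measurableT_comp (measurable_powR _)).
have mW : measurable_fun setT W.
  apply/measurable_EFinP; apply: measurable_funM.
    by apply: measurable_funM; [exact: (measurableT_comp m1 measurable_fst)|exact: (measurableT_comp m1 measurable_snd)].
  apply: measurable_funM.
    exact: (measurableT_comp (measurable_powR _) (Hker_measurable2 e0)).
  exact: (measurableT_comp mGp measurable_snd).
have E1 x : ball1 x -> (\int[mu3]_(y in @ball1 R) (Hker e x y `^ (3 * b) * G y `^ p)%:E
    = \int[smu3]_y W (x, y))%E.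
  move=> bx; rewrite integral_mkcond; apply: eq_integral => y _.
  rewrite patchE /W /= !indicE (mem_set bx) /= mulr1n mul1r.
  by case: (y \in _); rewrite /= ?mulr1n ?mulr0n ?mul1r ?mul0r.
have mF := @measurable_fun_fubini_tonelli_F _ _ _ _ _ smu3 W mW W0.
have mA : @measurable_fun _ _ mR3 _ (@ball1 R)
    (fun x => \int[mu3]_(y in @ball1 R) (Hker e x y `^ (3 * b) * G y `^ p)%:E)%E.
  apply: (@eq_measurable_fun _ _ _ _ _ (fun x => \int[smu3]_y W (x, y))%E).
    by move=> x; rewrite inE => bx; rewrite E1.
  exact: measurable_funTS mF.
split => //.
apply: (@le_trans _ _ (\int[smu3]_x \int[smu3]_y W (x, y))%E).
  rewrite integral_mkcond; apply: ge0_le_integral; first exact: measurableT.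
  - by move=> x _; rewrite patchE; case: ifP => // _; apply: integral_ge0 => y _; rewrite lee_fin mulr_ge0 ?powR_ge0.
  - exact: (measurable_restrictT _ mB).1 mA.
  - exact: mF.
  - move=> x _; rewrite patchE; case: ifPn => [|_]; last exact: integral_ge0.
    by rewrite inE => bx; rewrite E1.
rewrite (@fubini_tonelli _ _ _ _ _ smu3 smu3 W mW W0).
apply: (@le_trans _ _ (\int[smu3]_y (M%:E * (\1_(@ball1 R) y * G y `^ p)%:E))%E).
  apply: ge0_le_integral; first exact: measurableT.
  - by move=> y _; exact: integral_ge0.
  - exact: (@measurable_fun_fubini_tonelli_G _ _ _ _ _ smu3 W mW W0).
  - by apply/measurable_EFinP; apply: measurable_funM => //; exact: measurable_funM.
  move=> y _; rewrite /fubini_G.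
  have [bY|nbY] := pselect (ball1 y); last first.
    rewrite indicE (memNset nbY) /= mulr0n mul0r mule0 integral0_eq// => x _.
    by rewrite /W /= !indicE (memNset nbY) /= mulr0n mulr0 mul0r.
  have -> : (\int[smu3]_x W (x, y) = \int[mu3]_(x in @ball1 R) ((Hker e y x `^ (3 * b))%:E * (G y `^ p)%:E))%E.
    rewrite [RHS]integral_mkcond; apply: eq_integral => x _.
    rewrite patchE /W /= !indicE (mem_set bY) /= mulr1n mulr1 HkerC.
    by case: (x \in _); rewrite /= ?mulr1n ?mulr0n ?mul1r ?mul0r -?EFinM.
  rewrite ge0_integralZr//; last first.
  - by rewrite lee_fin powR_ge0.
  - by move=> x _; rewrite lee_fin powR_ge0.
  - apply/measurable_EFinP; apply: (measurableT_comp (measurable_powR _)).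
    exact: measurable_funTS (Hker_measurable _ e0).
  by rewrite indicE (mem_set bY) /= mulr1n mul1r lee_wpmul2r ?lee_fin ?powR_ge0//; exact: HM.
rewrite ge0_integralZl//.
- rewrite EFinM; apply: lee_wpmul2l; [by rewrite lee_fin|apply: le_trans GN].
  rewrite [leRHS]integral_mkcond le_eqVlt; apply/orP; left; apply/eqP.
  apply: eq_integral => y _; rewrite patchE indicE.
  by case: (y \in _); rewrite /= ?mulr1n ?mulr0n ?mul1r ?mul0r.
- by apply/measurable_EFinP; exact: measurable_funM.
- by move=> y _; rewrite lee_fin mulr_ge0 ?powR_ge0.
Qed.

End young.

Section limn_einf_bounds.
Variable R : realType.

(** The pointwise input to Fatou: only the real minorants [v] converge, while [a] may oscillate or
    be infinite. *)
Lemma limn_einf_ge (v : nat -> R) (l : R) (a : nat -> \bar R) :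
  v n @[n --> \oo] --> l -> (forall n, ((v n)%:E <= a n)%E) -> (l%:E <= limn_einf a)%E.
Proof.
move=> vl va.
have vlE : (v n)%:E @[n --> \oo] --> l%:E by apply: cvg_EFin => //; near=> n.
rewrite -(cvg_limn_einf_sup vlE).1 !limn_einf_lim.
apply: lee_lim; [exact: is_cvg_einfs|exact: is_cvg_einfs|apply: nearW => n].
apply: le_ereal_inf_tmp => _ [m /= nm <-].
by apply: le_trans (va m); apply: ereal_inf_lbound; exists m.
Unshelve. all: by end_near. Qed.

Lemma limn_einf_le (a : nat -> \bar R) (K : \bar R) :
  (forall n, (a n <= K)%E) -> (limn_einf a <= K)%E.
Proof.
move=> aK; rewrite limn_einf_lim; apply: lime_le; first exact: is_cvg_einfs.
apply: nearW => n; apply: le_trans (aK n).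
by apply: ereal_inf_lbound; exists n => /=.
Qed.

Lemma measurable_fun_limn_einf d (T : measurableType d) (D : set T) (f : nat -> T -> \bar R) :
  (forall n, measurable_fun D (f n)) -> measurable_fun D (fun x => limn_einf (f ^~ x)).
Proof.
move=> mf.
rewrite (_ : (fun x => _) = (fun x => - limn_esup (fun n => - f n x))%E); last first.
  by apply/funext => x; rewrite -limn_einfN; congr limn_einf; apply/funext => n /=; rewrite oppeK.
apply: measurableT_comp => //; apply: measurable_fun_limn_esup => n.
by apply: measurableT_comp.
Qed.

End limn_einf_bounds.

(** * The estimate for test functions *)

Section test_functions.
Variable R : realType.
Notation mR := (measurableTypeR R).
Notation mR3 := (mR * mR * mR)%type.
Notation mu := (@lebesgue_measure R).
Notation mu3 := (@lebesgue3 R).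

(** [holder3] asks for a positive real bound, whereas the inner integral [a] may be zero or
    infinite. A real [a] is enlarged by [d / (3 c)^k], which costs [d] in the end. *)
Lemma powR_le_of_bounds (J k c : R) (F a : \bar R) : 0 < c -> 0 < k -> (0 <= a)%E ->
  (`|J|%:E <= 3%:E * F)%E ->
  (forall A, 0 < A -> (a <= A%:E)%E -> (F <= (A `^ k^-1 * c)%:E)%E) ->
  ((`|J| `^ k)%:E <= ((3 * c) `^ k)%:E * a)%E.
Proof.
move=> c0 k0 a0 JF FA.
have c3 : 0 < (3 * c) `^ k by rewrite powR_gt0// mulr_gt0.
case: a a0 FA => [a| |] // a0 FA; last by rewrite gt0_muley ?lte_fin// leey.
rewrite lee_fin in a0; rewrite -EFinM lee_fin; apply/ler_addgt0Pr => d d0.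
pose A := a + d / (3 * c) `^ k.
have A0 : 0 < A by rewrite ltr_wpDl// divr_gt0.
have h : `|J| <= 3 * (A `^ k^-1 * c).
  rewrite -lee_fin (le_trans JF)// EFinM lee_pmul2l// FA// lee_fin /A lerDl.
  by rewrite divr_ge0// ltW.
have : `|J| `^ k <= (3 * (A `^ k^-1 * c)) `^ k.
  by apply: ge0_ler_powR; rewrite ?nnegrE ?mulr_ge0 ?powR_ge0 ?(ltW c0) ?(ltW k0).
have -> : 3 * (A `^ k^-1 * c) = (3 * c) * A `^ k^-1 by ring.
rewrite powRM ?powR_ge0 ?mulr_ge0 ?(ltW c0)// -powRrM mulVf ?lt0r_neq0// powRr1 ?(ltW A0)//.
move=> /le_trans; apply; rewrite /A mulrDr lerD2l mulrC -mulrA mulVf ?mulr1//.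
exact: lt0r_neq0.
Qed.

(** Hölder at fixed [x], with [A] bounding the inner integral, turns the [k]-th power of the mean
    into a multiple of that integral; Young's double integral bounds the result uniformly in [e],
    and Fatou removes [e]. *)
Lemma component_bound (u G : R * R * R -> R) (p k b M N : R) :
  1 <= p -> p <= k -> 0 < b -> (3 * b)^-1 = 1 + k^-1 - p^-1 -> 0 < M -> 0 < N ->
  cball u -> @measurable_fun _ _ mR3 mR setT G -> (forall y, 0 <= G y) ->
  (forall (e : R) (x : R * R * R), 0 < e <= 1 -> ball1 x ->
    (\int[mu3]_(y in @ball1 R) (Hker e x y `^ (3 * b))%:E <= M%:E)%E) ->
  (\int[mu3]_(y in @ball1 R) (G y `^ p)%:E <= N%:E)%E ->
  (forall e x, 0 < e -> (`|\int[mu3]_y (rho e x y * u y)|%:E <=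
     3%:E * \int[mu3]_(y in @ball1 R) (Hker e x y * G y)%:E)%E) ->
  (\int[mu3]_(x in @ball1 R) (`|crho R * u x| `^ k)%:E <=
     ((3 * (M `^ (1 - p^-1) * N `^ (p^-1 - k^-1))) `^ k * (M * N))%:E)%E.
Proof.
move=> p1 pk b0 bE M0 N0 cu mG G0 HM GN HJ.
have k0 : 0 < k by lra.
pose c := M `^ (1 - p^-1) * N `^ (p^-1 - k^-1).
have c0 : 0 < c by rewrite mulr_gt0 ?powR_gt0.
have mB := @ball1_measurable R.
pose e n : R := n.+1%:R^-1.
have e0 n : 0 < e n by rewrite /e invr_gt0.
have e01 n : 0 < e n <= 1 by rewrite e0 /e invf_le1// ler1n.
pose a n x := (\int[mu3]_(y in @ball1 R) (Hker (e n) x y `^ (3 * b) * G y `^ p)%:E)%E.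
have a0 n x : (0 <= a n x)%E by apply: integral_ge0 => y _; rewrite lee_fin mulr_ge0 ?powR_ge0.
have [ma Ia] : (forall n, @measurable_fun _ _ mR3 _ (@ball1 R) (a n)) /\
   forall n, (\int[mu3]_(x in @ball1 R) a n x <= (M * N)%:E)%E.
  by split=> n; have [] := young_integral (p := p) (e01 n) mG G0 (HM (e n) ^~ (e01 n)) GN.
have c3 : 0 <= (3 * c) `^ k by exact: powR_ge0.
apply: (@le_trans _ _ (\int[mu3]_(x in @ball1 R) limn_einf (fun n => ((3 * c) `^ k)%:E * a n x))%E).
  apply: ge0_le_integral => //.
  - apply/measurable_EFinP; apply: (measurableT_comp (measurable_powR _)).
    apply: measurableT_comp => //; apply: measurable_funTS; apply: continuous3_measurable => x.
    by apply: cvgM; [exact: cvg_cst|exact: cu.1].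
  - by apply: measurable_fun_limn_einf => n; apply: measurable_funeM; exact: ma.
  move=> x bx.
  (* Zeros of [u] are set apart because continuity of the [k]-th power is drawn from its derivative,
     taken at positive points. *)
  have [ux|ux] := eqVneq (u x) 0.
    rewrite ux mulr0 normr0 powR0 ?lt0r_neq0//; apply: (@limn_einf_ge _ (fun=> 0)); first exact: cvg_cst.
    by move=> n; rewrite mule_ge0.
  apply: (@limn_einf_ge _ (fun n => `|\int[mu3]_y (rho (e n) x y * u y)| `^ k)).
    have u0 : 0 < `|crho R * u x|.
      by rewrite normr_gt0 mulf_neq0// lt0r_neq0// crho_gt0.
    have ck : {for `|crho R * u x|, continuous (fun t => t `^ k)}.
      apply: differentiable_continuous; apply/derivable1_diffP.
      by case: (is_derive1_powR k u0).
    apply: (@cvg_comp _ _ _ (fun n => `|\int[mu3]_y (rho (e n) x y * u y)|) (fun t => t `^ k) _ (nbhs `|crho R * u x|)) => //.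
    by apply: cvg_norm; exact: rho_cvg.
  move=> n; apply: powR_le_of_bounds (HJ (e n) x (e0 n)) _ => // A A0 aA.
  apply: (@holder3 _ _ _ mu3 (@ball1 R) (Hker (e n) x) G p k (3 * b) A M N) => //.
  - by apply: measurable_funTS; exact: Hker_measurable.
  - exact: measurable_funTS.
  - exact: Hker_ge0.
  - by rewrite mulr_gt0.
  - exact: HM.
apply: le_trans (fatou _ _ _ _) _ => //.
- by move=> n; apply: measurable_funeM; exact: ma.
- by move=> n x _; rewrite mule_ge0.
apply: limn_einf_le => n; rewrite ge0_integralZl//.
by rewrite EFinM lee_wpmul2l ?lee_fin.
Qed.

End test_functions.

Section test_inequality.
Variable R : realType.
Notation mR := (measurableTypeR R).
Notation mR3 := (mR * mR * mR)%type.
Notation mu3 := (@lebesgue3 R).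

Lemma vnorm_sqr (v : 'cV[R[i]]_4) :
  vnorm v ^+ 2 = \sum_k (complex.Re (v k ord0) ^+ 2 + complex.Im (v k ord0) ^+ 2).
Proof. by rewrite sqr_sqrtr// sumr_ge0// => k _; rewrite addr_ge0 ?sqr_ge0. Qed.

(** If [m^k] is the sum on the right, each of the eight real components is at most [m] in modulus,
    so [|v|^2 <= 8 m^2 <= (8 m)^2]. *)
Lemma vnorm_powR_le (v : 'cV[R[i]]_4) (k : R) : 0 < k ->
  vnorm v `^ k <= 8 `^ k * \sum_l (`|complex.Re (v l ord0)| `^ k + `|complex.Im (v l ord0)| `^ k).
Proof.
move=> k0; pose F l := `|complex.Re (v l ord0)| `^ k + `|complex.Im (v l ord0)| `^ k.
have F0 l : 0 <= F l by rewrite addr_ge0 ?powR_ge0.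
rewrite -/(F _); set S := \sum_l _.
have S0 : 0 <= S by apply: sumr_ge0.
have FS l : F l <= S by rewrite /S (bigD1 l)//= lerDl; apply: sumr_ge0.
pose m := S `^ k^-1.
have m0 : 0 <= m by exact: powR_ge0.
have mS : m `^ k = S by rewrite /m -powRrM mulVf ?powRr1// lt0r_neq0.
have sm (s : R) : `|s| `^ k <= S -> s ^+ 2 <= m ^+ 2.
  move=> h; have : (`|s| `^ k) `^ k^-1 <= m.
    by apply: ge0_ler_powR; rewrite ?nnegrE ?powR_ge0 ?invr_ge0 ?(ltW k0).
  rewrite -powRrM mulfV ?lt0r_neq0// powRr1// => h2.
  by rewrite -real_normK ?num_real// ler_pXn2r ?nnegrE.
have vm : vnorm v <= 8 * m.
  rewrite -(ler_pXn2r (n:=2)) ?nnegrE ?sqrtr_ge0 ?mulr_ge0// vnorm_sqr exprMn.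
  apply: (@le_trans _ _ (\sum_(l < 4) (m ^+ 2 + m ^+ 2))).
    apply: ler_sum => l _; apply: lerD; apply: sm; apply: le_trans (FS l).
      by rewrite /F lerDl powR_ge0.
    by rewrite /F lerDr powR_ge0.
  by rewrite sumr_const card_ord -mulr_natl; have := sqr_ge0 m; lra.
rewrite -mS -powRM//.
by apply: ge0_ler_powR; rewrite ?nnegrE ?sqrtr_ge0 ?mulr_ge0 ?(ltW k0).
Qed.

Lemma test_function_bound (p k : R) : 1 <= p -> p <= k -> k < p * (p + 3) / 3 ->
  exists2 C : R, 0 < C & forall (f : R * R * R -> 'cV[R[i]]_4) A, test_function f -> 0 < A ->
  (\int[mu3]_(y in @ball1 R) (vnorm (alpha_p f y) `^ p)%:E <= (A `^ p)%:E)%E ->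
  (\int[mu3]_(y in @ball1 R) (vnorm (f y) `^ k)%:E <= (C * A `^ k)%:E)%E.
Proof.
move=> p1 pk kp.
have p0 : 0 < p by lra.
have k0 : 0 < k by lra.
pose s := 1 + k^-1 - p^-1.
(* Here the upper bound on [k] is consumed: the inverse of [p (p + 3) / 3] is [1/p - 1/(p + 3)], and
   [1/(p + 3) <= 1/3]. *)
have s23 : 2 / 3 < s.
  have h1 : (p * (p + 3) / 3)^-1 < k^-1 by rewrite ltf_pV2 ?posrE// (lt_trans k0).
  have -> : s = (1 - p^-1) + k^-1 by rewrite /s; ring.
  have h2 : (p * (p + 3) / 3)^-1 = p^-1 - (p + 3)^-1.
    have pn0 : p != 0 by exact: lt0r_neq0.
    have p3 : p + 3 != 0 by rewrite lt0r_neq0//; lra.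
    by field; rewrite ?p3 ?pn0.
  have h3 : (p + 3)^-1 <= 3^-1 by rewrite lef_pV2 ?posrE//; lra.
  lra.
pose b := s^-1 / 3.
have s0 : 0 < s by lra.
have b0 : 0 < b by rewrite divr_gt0 ?invr_gt0.
have E3b : 3 * b = s^-1 by rewrite /b; field; exact: lt0r_neq0.
have bE : (3 * b)^-1 = 1 + k^-1 - p^-1 by rewrite E3b invrK.
have b2 : 2 * b < 1.
  have : s^-1 < (2 / 3)^-1 by rewrite ltf_pV2 ?posrE.
  rewrite invf_div; lra.
have [M M0 HM] := integral_Hker_le (ltW b0) b2.
pose K := 3 * M `^ (1 - p^-1).
have K0 : 0 < K by rewrite mulr_gt0 ?powR_gt0.
have cr := crho_gt0 R.
pose C1 := (crho R `^ k)^-1 * (K `^ k * M).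
have C10 : 0 < C1 by rewrite !mulr_gt0 ?invr_gt0 ?powR_gt0.
exists (8 `^ k * (8 * C1)); first by apply: mulr_gt0; [exact: powR_gt0|exact: mulr_gt0].
move=> f A tf A0 IA.
have mB := @ball1_measurable R.
have mG := measurable_alpha_p (D := setT) tf.
have N0 : 0 < A `^ p by rewrite powR_gt0.
have mu_ u : cball u -> @measurable_fun _ _ mR3 mR (@ball1 R) (fun x => `|u x| `^ k).
  move=> cu; apply: (measurableT_comp (measurable_powR _)); apply: measurableT_comp => //.
  by apply: measurable_funTS; apply: continuous3_measurable; exact: cu.1.
have comp u : cball u ->
  (forall e x, 0 < e -> (`|\int[mu3]_y (rho e x y * u y)|%:E <=
     3%:E * \int[mu3]_(y in @ball1 R) (Hker e x y * vnorm (alpha_p f y))%:E)%E) ->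
  (\int[mu3]_(x in @ball1 R) (`|u x| `^ k)%:E <= (C1 * A `^ k)%:E)%E.
  move=> cu HJ.
  have := component_bound p1 pk b0 bE M0 N0 cu mG (fun y => vnorm_ge0 _) HM IA HJ.
  (* Homogeneity: the powers of [A] are [k - p] from the Hölder constant and [p] from the double
     integral. *)
  have -> : (3 * (M `^ (1 - p^-1) * (A `^ p) `^ (p^-1 - k^-1))) `^ k * (M * A `^ p) = K `^ k * M * A `^ k.
    have -> : 3 * (M `^ (1 - p^-1) * (A `^ p) `^ (p^-1 - k^-1)) = K * (A `^ p) `^ (p^-1 - k^-1).
      by rewrite mulrA.
    rewrite powRM ?powR_ge0 ?(ltW K0)// -!powRrM.
    have -> : A `^ k = A `^ (p * (p^-1 - k^-1) * k) * A `^ p.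
      rewrite -powRD; last by rewrite (gt_eqF A0) implybT.
      by congr (_ `^ _); field; rewrite !lt0r_neq0.
    by rewrite mulrACA (mulrA p).
  move=> h.
  have -> : (\int[mu3]_(x in @ball1 R) (`|u x| `^ k)%:E = ((crho R `^ k)^-1)%:E *
     \int[mu3]_(x in @ball1 R) (`|crho R * u x| `^ k)%:E)%E.
    rewrite -ge0_integralZl//; last 2 first.
    - apply/measurable_EFinP; apply: (mu_ (fun x => crho R * u x)); exact: cballZ.
    - by rewrite lee_fin invr_ge0 powR_ge0.
    apply: eq_integral => x _; rewrite -EFinM; congr EFin.
    rewrite normrM powRM// (gtr0_norm cr) mulrA mulVf ?mul1r//.
    by rewrite lt0r_neq0// powR_gt0.
  rewrite /C1 -mulrA EFinM; apply: lee_wpmul2l => //.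
  by rewrite lee_fin invr_ge0 powR_ge0.
have cr_ l : cball (re_comp f l) by have [[]] := test_function_C1ball l tf.
have ci_ l : cball (im_comp f l) by have [_ []] := test_function_C1ball l tf.
have Ir l : (\int[mu3]_(x in @ball1 R) (`|re_comp f l x| `^ k)%:E <= (C1 * A `^ k)%:E)%E.
  by apply: comp => // e x e0; have [] := dirac_bound x l e0 tf.
have Ii l : (\int[mu3]_(x in @ball1 R) (`|im_comp f l x| `^ k)%:E <= (C1 * A `^ k)%:E)%E.
  by apply: comp => // e x e0; have [] := dirac_bound x l e0 tf.
have mri l : @measurable_fun _ _ mR3 mR (@ball1 R) (fun x => `|re_comp f l x| `^ k + `|im_comp f l x| `^ k).
  by apply: measurable_funD; exact: mu_.
have mriE l : @measurable_fun _ _ mR3 _ (@ball1 R) (fun x => (`|re_comp f l x| `^ k + `|im_comp f l x| `^ k)%:E).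
  by apply/measurable_EFinP; exact: mri.
apply: (@le_trans _ _ (\int[mu3]_(y in @ball1 R) ((8 `^ k)%:E *
   \sum_l (`|re_comp f l y| `^ k + `|im_comp f l y| `^ k)%:E))%E).
  apply: ge0_le_integral => //.
  - by move=> y _; rewrite lee_fin powR_ge0.
  - apply/measurable_EFinP; apply: (measurableT_comp (measurable_powR _)).
    apply: measurable_vnorm => l; split; apply: measurable_funTS; apply: continuous3_measurable.
      exact: (cr_ l).1.
    exact: (ci_ l).1.
  - by apply: measurable_funeM; apply: emeasurable_sum => l; exact: mriE.
  by move=> y _; rewrite sumEFin -EFinM lee_fin; exact: vnorm_powR_le.
rewrite ge0_integralZl; [|exact: mB|by apply: emeasurable_sum => l; exact: mriE| |by rewrite lee_fin powR_ge0]; last first.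
  by move=> y _; apply: sume_ge0 => l _; rewrite lee_fin addr_ge0 ?powR_ge0.
rewrite -mulrA EFinM; apply: lee_wpmul2l; first by rewrite lee_fin powR_ge0.
rewrite ge0_integral_sum; [|exact: mB|exact: mriE|
  by move=> l y _; rewrite lee_fin addr_ge0 ?powR_ge0].
apply: (@le_trans _ _ (\sum_(l < 4) (2 * (C1 * A `^ k))%:E)%E).
  apply: lee_sum => l _.
  under eq_integral do rewrite EFinD.
  rewrite ge0_integralD; [|exact: mB|by move=> y _; rewrite lee_fin powR_ge0|
    by apply/measurable_EFinP; exact: mu_|by move=> y _; rewrite lee_fin powR_ge0|
    by apply/measurable_EFinP; exact: mu_].
  by rewrite mulr_natl mulr2n EFinD leeD.
rewrite sumEFin lee_fin sumr_const card_ord -mulr_natl.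
by rewrite le_eqVlt; apply/orP; left; apply/eqP; ring.
Qed.

End test_inequality.

(** * Passage to the completion *)

Section completion.
Variable R : realType.
Notation mR := (measurableTypeR R).
Notation mR3 := (mR * mR * mR)%type.
Notation mu3 := (@lebesgue3 R).

(** With the factor [2] it follows from [(a + b)^2 <= 2 (a^2 + b^2)] in each component, without
    Cauchy-Schwarz. *)
Lemma vnorm_quasi_triangle (v w : 'cV[R[i]]_4) : vnorm v <= 2 * (vnorm w + vnorm (w - v)).
Proof.
have v0 := @vnorm_ge0 R.
rewrite -(ler_pXn2r (n:=2)) ?nnegrE ?mulr_ge0 ?addr_ge0//.
apply: (@le_trans _ _ (2 * (vnorm w ^+ 2 + vnorm (w - v) ^+ 2))); last first.
  by have := mulr_ge0 (v0 w) (v0 (w - v)); nra.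
rewrite !vnorm_sqr -big_split/= mulr_sumr; apply: ler_sum => l _.
rewrite !mxE; case: (v l ord0) => a b; case: (w l ord0) => c d /=.
by have := sqr_ge0 (c - (c - a)); have := sqr_ge0 (d - (d - b)); have := sqr_ge0 (c + (c - a)); have := sqr_ge0 (d + (d - b)); nra.
Qed.

Lemma powRD_le (a b p : R) : 0 <= a -> 0 <= b -> 0 < p ->
  (a + b) `^ p <= 2 `^ p * (a `^ p + b `^ p).
Proof.
move=> a0 b0 p0.
wlog ab : a b a0 b0 / a <= b.
  move=> h; have [ab|/ltW ba] := leP a b; first exact: h.
  by rewrite addrC [_ + b `^ p]addrC; exact: h.
apply: (@le_trans _ _ ((2 * b) `^ p)).
  by apply: ge0_ler_powR; rewrite ?nnegrE ?addr_ge0 ?mulr_ge0 ?(ltW p0)//; lra.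
by rewrite powRM// ler_wpM2l ?powR_ge0// lerDr powR_ge0.
Qed.

Lemma vnormN (v : 'cV[R[i]]_4) : vnorm (- v) = vnorm v.
Proof.
by congr Num.sqrt; apply: eq_bigr => l _; rewrite !mxE; case: (v l ord0) => a b /=; rewrite !sqrrN.
Qed.

Lemma minr_quasi (a b c t : R) : 0 <= a -> 0 <= b -> 0 < t -> c <= 2 * (a + b) ->
  Num.min c t <= 2 * (a + Num.min b t).
Proof.
move=> a0 b0 t0 h; rewrite ge_min; apply/orP.
by have [bt|tb] := leP b t; [left|right]; lra.
Qed.

(** Of the [k] powers of the minimum, [k - p] are bounded by [t] and [p] by [b]. *)
Lemma minr_powR_le (b t p k : R) : 0 <= b -> 0 < t -> 0 < p -> p <= k ->
  Num.min b t `^ k <= t `^ (k - p) * b `^ p.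
Proof.
move=> b0 t0 p0 pk.
have m0 : 0 <= Num.min b t by rewrite le_min b0 ltW.
have [mz|mn] := eqVneq (Num.min b t) 0.
  by rewrite mz powR0 ?mulr_ge0 ?powR_ge0// lt0r_neq0// (lt_le_trans p0).
have -> : Num.min b t `^ k = Num.min b t `^ (k - p) * Num.min b t `^ p.
  by rewrite -powRD ?subrK// mn implybT.
apply: ler_pM; rewrite ?powR_ge0//.
  by apply: ge0_ler_powR; rewrite ?nnegrE ?subr_ge0 ?(ltW t0)// ge_min lexx orbT.
by apply: ge0_ler_powR; rewrite ?nnegrE ?(ltW p0)// ge_min lexx.
Qed.

Lemma measurable_vnormB (f g : R * R * R -> 'cV[R[i]]_4) :
  (forall k, @measurable_fun _ _ mR3 mR (@ball1 R) (re_comp g k) /\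
             @measurable_fun _ _ mR3 mR (@ball1 R) (im_comp g k)) ->
  measurable_on_ball f ->
  @measurable_fun _ _ mR3 mR (@ball1 R) (fun y => vnorm (g y - f y)).
Proof.
move=> mg mf; apply: measurable_vnorm => k.
have [gr gi] := mg k; have [fr fi] := mf k.
have Er : re_comp (fun y => g y - f y) k = (fun y => re_comp g k y - re_comp f k y).
  by apply/funext => y; rewrite /re_comp !mxE; case: (g y k ord0); case: (f y k ord0).
have Ei : im_comp (fun y => g y - f y) k = (fun y => im_comp g k y - im_comp f k y).
  by apply/funext => y; rewrite /im_comp !mxE; case: (g y k ord0); case: (f y k ord0).
by rewrite Er Ei; split; exact: measurable_funB.
Qed.

(** Both integrands are dominated by their sum, whose integral is the [p]-th power of the graph
    norm. *)
Lemma dirac_sobolev_close (p : R) (f : dirac_sobolev p) (d : R) : 1 <= p -> 0 < d ->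
  exists2 phi, test_function phi &
   (\int[mu3]_(y in @ball1 R) (vnorm (alpha_p phi y - ds_dirac f y) `^ p)%:E <= d%:E)%E /\
   (\int[mu3]_(y in @ball1 R) (vnorm (phi y - ds_fun f y) `^ p)%:E <= d%:E)%E.
Proof.
move=> p1 d0; have p0 : 0 < p by lra.
have [phi [tphi cphi]] := ds_approx f.
have mB := @ball1_measurable R.
have dp : (0 < (d `^ p^-1)%:E :> \bar R)%E by rewrite lte_fin powR_gt0.
have nd : nbhs (0 : \bar R)%E [set y | (y < (d `^ p^-1)%:E)%E].
  by apply: open_nbhs_nbhs; split; [exact: open_ereal_lt_ereal|].
have [n /= Hn] := @filter_ex _ \oo _ _ (cphi _ nd).
have t := tphi n.
pose a y := vnorm (alpha_p (phi n) y - ds_dirac f y) `^ p.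
pose b y := vnorm (phi n y - ds_fun f y) `^ p.
have a0 y : 0 <= a y by exact: powR_ge0.
have b0 y : 0 <= b y by exact: powR_ge0.
have mpow g : @measurable_fun _ _ mR3 mR (@ball1 R) g ->
   @measurable_fun _ _ mR3 mR (@ball1 R) (fun y => g y `^ p).
  by move=> mg; exact: (measurableT_comp (measurable_powR _) mg).
have ma : @measurable_fun _ _ mR3 mR (@ball1 R) a.
  apply: mpow; apply: measurable_vnormB; last exact: ds_dirac_measurable.
  move=> k; have [[c1 _] [c2 _]] := alpha_p_cball k t.
  by split; apply: measurable_funTS; exact: continuous3_measurable.
have mb : @measurable_fun _ _ mR3 mR (@ball1 R) b.
  apply: mpow; apply: measurable_vnormB; last exact: ds_fun_measurable.
  move=> k; have [[[c1 _] _] [[c2 _] _]] := test_function_C1ball k t.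
  by split; apply: measurable_funTS; exact: continuous3_measurable.
pose I := (\int[mu3]_(y in @ball1 R) (a y + b y)%:E)%E.
have I0 : (0 <= I)%E.
  apply: integral_ge0.
  move=> y _.
  rewrite lee_fin.
  exact: (addr_ge0 (a0 y) (b0 y)).
have Id : (I <= d%:E)%E.
  rewrite leNgt; apply/negP => dI.
  have : (d%:E `^ p^-1 <= I `^ p^-1)%E.
    apply: gt0_ler_poweR; last exact: ltW.
    - by rewrite invr_ge0 ltW.
    - by rewrite in_itv/= leey andbT lee_fin ltW.
    - by rewrite in_itv/= leey andbT.
  rewrite poweR_EFin => /(lt_le_trans (Hn : (I `^ p^-1 < _)%E)).
  by rewrite ltxx.
have mab : @measurable_fun _ _ mR3 _ (@ball1 R) (fun y => (a y + b y)%:E).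
  by apply/measurable_EFinP; exact: measurable_funD ma mb.
have aab y : a y <= a y + b y by rewrite lerDl; exact: b0 y.
have bab y : b y <= a y + b y by rewrite lerDr; exact: a0 y.
exists (phi n); first exact: t.
split; apply: le_trans Id.
- apply: ge0_le_integral; [exact: mB|by move=> y _; rewrite lee_fin powR_ge0| |exact: mab|
    by move=> y _; rewrite lee_fin; exact: aab y].
  by apply/measurable_EFinP; exact: ma.
- apply: ge0_le_integral; [exact: mB|by move=> y _; rewrite lee_fin powR_ge0| |exact: mab|
    by move=> y _; rewrite lee_fin; exact: bab y].
  by apply/measurable_EFinP; exact: mb.
Qed.

Lemma dirac_sobolev_bound (p k : R) : 1 <= p -> p <= k -> k < p * (p + 3) / 3 ->
  exists2 C : R, 0 < C & forall (f : dirac_sobolev p) A, 0 < A ->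
  (\int[mu3]_(y in @ball1 R) (vnorm (ds_dirac f y) `^ p)%:E <= (A `^ p)%:E)%E ->
  (\int[mu3]_(y in @ball1 R) (vnorm (ds_fun f y) `^ k)%:E <= (C * A `^ k)%:E)%E.
Proof.
move=> p1 pk kp; have [C C0 HC] := test_function_bound p1 pk kp.
have p0 : 0 < p by lra.
have k0 : 0 < k by lra.
exists (4 `^ k * (C * 8 `^ k)); first by rewrite !mulr_gt0 ?powR_gt0.
move=> f A A0 IA.
have mB := @ball1_measurable R.
have v0 := @vnorm_ge0 R.
have Ap0 : 0 < A `^ p by rewrite powR_gt0.
have mF : @measurable_fun _ _ mR3 mR (@ball1 R) (fun y => vnorm (ds_fun f y)).
  by apply: measurable_vnorm; exact: ds_fun_measurable.
have mG : @measurable_fun _ _ mR3 mR (@ball1 R) (fun y => vnorm (ds_dirac f y)).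
  by apply: measurable_vnorm; exact: ds_dirac_measurable.
have mpow q g : @measurable_fun _ _ mR3 mR (@ball1 R) g ->
   @measurable_fun _ _ mR3 mR (@ball1 R) (fun y => g y `^ q).
  by move=> mg; exact: (measurableT_comp (measurable_powR _) mg).
have mE g : @measurable_fun _ _ mR3 mR (@ball1 R) g ->
   @measurable_fun _ _ mR3 _ (@ball1 R) (fun y => (g y)%:E).
  by move=> mg; apply/measurable_EFinP.
pose K := 4 `^ k * (C * 8 `^ k) * A `^ k.
(* Truncating [|f|] at [T] turns the [L^p] distance to the test functions into
   an [L^k] one. *)
have trunc T : 0 < T ->
  (\int[mu3]_(y in @ball1 R) (Num.min (vnorm (ds_fun f y)) T `^ k)%:E <= K%:E)%E.
  move=> T0; apply/lee_addgt0Pr => e e0.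
  pose T' := 4 `^ k * T `^ (k - p).
  have T'0 : 0 < T' by rewrite mulr_gt0 ?powR_gt0.
  (* The first bound keeps the Dirac norm of [phi] below [8 A]; the second makes the truncation
     error, multiplied by [T'], at most [e]. *)
  pose d := Num.min (A `^ p) (e / T').
  have d0 : 0 < d by rewrite lt_min Ap0 divr_gt0.
  have [phi tphi [Ig If]] := dirac_sobolev_close f p1 d0.
  have m1 : @measurable_fun _ _ mR3 mR (@ball1 R) (fun y => vnorm (alpha_p phi y - ds_dirac f y)).
    apply: measurable_vnormB; last exact: ds_dirac_measurable.
    move=> l; have [[c1 _] [c2 _]] := alpha_p_cball l tphi.
    by split; apply: measurable_funTS; exact: continuous3_measurable.
  have mc l : @measurable_fun _ _ mR3 mR (@ball1 R) (re_comp phi l) /\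
             @measurable_fun _ _ mR3 mR (@ball1 R) (im_comp phi l).
    have [[[c1 _] _] [[c2 _] _]] := test_function_C1ball l tphi.
    by split; apply: measurable_funTS; exact: continuous3_measurable.
  have m2 : @measurable_fun _ _ mR3 mR (@ball1 R) (fun y => vnorm (phi y - ds_fun f y)).
    by apply: measurable_vnormB => //; exact: ds_fun_measurable.
  have m3 : @measurable_fun _ _ mR3 mR (@ball1 R) (fun y => vnorm (phi y)) by exact: measurable_vnorm.
  have m4 := measurable_alpha_p (D := @ball1 R) tphi.
  (* The quasi-triangle inequality and [powRD_le] give a factor [2^p] each, and the two integrals
     add up to [2 A^p <= 2^p A^p], as [p >= 1]. *)
  have I8 : (\int[mu3]_(y in @ball1 R) (vnorm (alpha_p phi y) `^ p)%:E <= ((8 * A) `^ p)%:E)%E.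
    apply: (@le_trans _ _ (\int[mu3]_(y in @ball1 R) ((4 `^ p)%:E *
        ((vnorm (ds_dirac f y) `^ p)%:E + (vnorm (alpha_p phi y - ds_dirac f y) `^ p)%:E)))%E).
      apply: ge0_le_integral; [exact: mB|by move=> y _; rewrite lee_fin powR_ge0|exact: mE (mpow _ _ m4)| |].
        by apply: measurable_funeM; apply: emeasurable_funD; exact: mE (mpow _ _ _).
      move=> y _; rewrite -EFinD -EFinM lee_fin.
      have := vnorm_quasi_triangle (alpha_p phi y) (ds_dirac f y).
      rewrite (_ : vnorm (ds_dirac f y - alpha_p phi y) = vnorm (alpha_p phi y - ds_dirac f y)); last first.
        by rewrite -vnormN opprB.
      move=> h; apply: (@le_trans _ _ ((2 * (vnorm (ds_dirac f y) + vnorm (alpha_p phi y - ds_dirac f y))) `^ p)).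
        by apply: ge0_ler_powR; rewrite ?nnegrE ?mulr_ge0 ?addr_ge0 ?(ltW p0).
      rewrite powRM ?addr_ge0//; have -> : 4 `^ p = 2 `^ p * 2 `^ p.
        by rewrite -powRM ?ler0n//; congr (_ `^ _); rewrite -natrM.
      by rewrite -mulrA ler_wpM2l ?powR_ge0// powRD_le.
    rewrite ge0_integralZl; [|exact: mB|by apply: emeasurable_funD; exact: mE (mpow _ _ _)|
      by move=> y _; rewrite adde_ge0// lee_fin powR_ge0|by rewrite lee_fin powR_ge0].
    rewrite ge0_integralD; [|exact: mB|by move=> y _; rewrite lee_fin powR_ge0|exact: mE (mpow _ _ _)|
      by move=> y _; rewrite lee_fin powR_ge0|exact: mE (mpow _ _ _)].
    apply: (@le_trans _ _ ((4 `^ p)%:E * ((A `^ p)%:E + (A `^ p)%:E))%E).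
      apply: lee_wpmul2l; first by rewrite lee_fin powR_ge0.
      by apply: leeD; [exact: IA|apply: le_trans Ig _; rewrite lee_fin /d ge_min lexx].
    rewrite -EFinD -EFinM lee_fin (_ : 8 * A = 4 * 2 * A); last by lra.
    rewrite !powRM ?mulr_ge0 ?(ltW A0)// -mulrA ler_wpM2l ?powR_ge0//.
    have h2 : 2 <= 2 `^ p :> R by apply: le1r_powR; [lra|exact: p1].
    by have := ler_wpM2r (ltW Ap0) h2; rewrite mulr_natl mulr2n.
  have A8 : 0 < 8 * A by exact: mulr_gt0.
  have I9 := HC phi (8 * A) tphi A8 I8.
  apply: (@le_trans _ _ (\int[mu3]_(y in @ball1 R) ((4 `^ k)%:E *
        ((vnorm (phi y) `^ k)%:E + (T `^ (k - p))%:E * (vnorm (phi y - ds_fun f y) `^ p)%:E)))%E).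
    apply: ge0_le_integral; [exact: mB|by move=> y _; rewrite lee_fin powR_ge0| | |].
    - by apply: mE; apply: mpow; apply: measurable_minr.
    - by apply: measurable_funeM; apply: emeasurable_funD; [|apply: measurable_funeM]; exact: mE (mpow _ _ _).
    move=> y _; change ((Num.min (vnorm (ds_fun f y)) T `^ k)%:E <= (4 `^ k *
      (vnorm (phi y) `^ k + T `^ (k - p) * vnorm (phi y - ds_fun f y) `^ p))%:E)%E.
    rewrite lee_fin.
    have := vnorm_quasi_triangle (ds_fun f y) (phi y).
    set F := vnorm (ds_fun f y); set P := vnorm (phi y); set D := vnorm (phi y - ds_fun f y) => h.
    have F0 : 0 <= F by exact: v0.
    have P0 : 0 <= P by exact: v0.
    have D0 : 0 <= D by exact: v0.
    have mD0 : 0 <= Num.min D T by rewrite le_min D0 ltW.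
    have h2 := minr_quasi P0 D0 T0 h.
    have h3 := minr_powR_le D0 T0 p0 pk.
    apply: (@le_trans _ _ ((2 * (P + Num.min D T)) `^ k)).
      by apply: ge0_ler_powR; rewrite ?nnegrE ?mulr_ge0 ?addr_ge0 ?(ltW k0)// le_min F0 ltW.
    rewrite powRM ?addr_ge0//; have -> : 4 `^ k = 2 `^ k * 2 `^ k.
      by rewrite -powRM ?ler0n//; congr (_ `^ _); rewrite -natrM.
    rewrite -mulrA ler_wpM2l ?powR_ge0// (le_trans (powRD_le P0 mD0 k0))//.
    by rewrite ler_wpM2l ?powR_ge0// lerD2l.
  rewrite ge0_integralZl; [|exact: mB|
      by apply: emeasurable_funD; [|apply: measurable_funeM]; exact: mE (mpow _ _ _)|
      by move=> y _; rewrite adde_ge0// -?EFinM lee_fin ?mulr_ge0 ?powR_ge0|by rewrite lee_fin powR_ge0].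
  rewrite ge0_integralD; [|exact: mB|by move=> y _; rewrite lee_fin powR_ge0|exact: mE (mpow _ _ _)|
      by move=> y _; rewrite -EFinM lee_fin mulr_ge0 ?powR_ge0|apply: measurable_funeM; exact: mE (mpow _ _ _)].
  rewrite ge0_integralZl; [|exact: mB|exact: mE (mpow _ _ _)|
      by move=> y _; rewrite lee_fin powR_ge0|by rewrite lee_fin powR_ge0].
  apply: (@le_trans _ _ ((4 `^ k)%:E * ((C * (8 * A) `^ k)%:E + (T `^ (k - p))%:E * (e / T')%:E))%E).
    apply: lee_wpmul2l; first by rewrite lee_fin powR_ge0.
    apply: leeD; [exact: I9|apply: lee_wpmul2l; first by rewrite lee_fin powR_ge0].
    by apply: le_trans If _; rewrite lee_fin /d ge_min lexx orbT.
  change ((4 `^ k * (C * (8 * A) `^ k + T `^ (k - p) * (e / T')))%:E <= (K + e)%:E)%E.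
  rewrite lee_fin mulrDr lerD//.
    by rewrite /K powRM ?(ltW A0)// !mulrA.
  by rewrite mulrA -/T' mulrCA mulfV ?mulr1// lt0r_neq0.
(* The level [n + 1] is positive, as [trunc] asks. At each point the truncation is eventually
   inactive, and the bound [K] is independent of the level. *)
pose F n y := (Num.min (vnorm (ds_fun f y)) n.+1%:R `^ k)%:E.
have mFn n : @measurable_fun _ _ mR3 _ (@ball1 R) (F n).
  by apply: mE; apply: mpow; apply: measurable_minr.
apply: (@le_trans _ _ (\int[mu3]_(y in @ball1 R) limn_einf (F ^~ y))%E).
  apply: ge0_le_integral; [exact: mB|by move=> y _; rewrite lee_fin powR_ge0|exact: mE (mpow _ _ _)| |].
    exact: measurable_fun_limn_einf.
  move=> y _; apply: (@limn_einf_ge _ (fun n => Num.min (vnorm (ds_fun f y)) n.+1%:R `^ k)) => //.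
  apply: cvg_near_cst; near=> n.
  rewrite min_l// (@le_trans _ _ n%:R)// ?ler_nat//.
  near: n; exact: nbhs_infty_ger.
apply: le_trans (fatou _ mB mFn _) _; first by move=> n y _; rewrite lee_fin powR_ge0.
by apply: limn_einf_le => n; exact: trunc.
Unshelve. all: by end_near. Qed.

End completion.

Theorem corollary2 (R : realType) (p k : R)
    (hp : 1 <= p) (hk1 : 1 <= k) (hk2 : k < p * (p + 3) / 3) :
  exists2 C : R, 0 < C &
    forall f : dirac_sobolev p,
      (Lnorm_ball k (ds_fun f) <= C%:E * Lnorm_ball p (ds_dirac f))%E.
Proof.
have p0 : 0 < p by lra.
have k0 : 0 < k by lra.
have mB := @ball1_measurable R.
(* [p] itself lies below [p (p + 3) / 3], so the estimate is available at [k'], which is at least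
   [p]. *)
pose k' := Num.max p k.
have k'0 : 0 < k' by rewrite lt_max p0.
have kk' : k <= k' by rewrite le_max lexx orbT.
have pk' : p <= k' by rewrite le_max lexx.
have hk' : k' < p * (p + 3) / 3 by rewrite gt_max hk2 andbT; nra.
have [C C0 HC] := dirac_sobolev_bound hp pk' hk'.
pose B := fine (lebesgue3 R (@ball1 R)).
have BE : lebesgue3 R (@ball1 R) = B%:E.
  by rewrite fineK// ge0_fin_numE ?ball1_fin.
have B0 : 0 <= B by rewrite fine_ge0.
(* To descend from [k'] to [k], compare [|f|] with [A]: where it is smaller, [A^k] is integrated and
   yields the volume [B]; where it is larger, [|f|^k <= A^(k - k') |f|^k'] yields [C]. Taking [A] as
   threshold keeps both terms proportional to [A^k]. *)
pose C' := C + B.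
have C'0 : 0 < C' by rewrite ltr_wpDr.
have main (f : dirac_sobolev p) A : 0 < A ->
  (\int[@lebesgue3 R]_(y in @ball1 R) (vnorm (ds_dirac f y) `^ p)%:E <= (A `^ p)%:E)%E ->
  (\int[@lebesgue3 R]_(y in @ball1 R) (vnorm (ds_fun f y) `^ k)%:E <= (C' * A `^ k)%:E)%E.
  move=> A0 /(HC f A A0) IA.
  have mF : @measurable_fun _ _ (measurableTypeR R * measurableTypeR R * measurableTypeR R)%type
      (measurableTypeR R) (@ball1 R) (fun y => vnorm (ds_fun f y)).
    by apply: measurable_vnorm; exact: ds_fun_measurable.
  have mFk q : @measurable_fun _ _ (measurableTypeR R * measurableTypeR R * measurableTypeR R)%type
      _ (@ball1 R) (fun y => (vnorm (ds_fun f y) `^ q)%:E).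
    by apply/measurable_EFinP; exact: (measurableT_comp (measurable_powR _) mF).
  apply: (@le_trans _ _ (\int[@lebesgue3 R]_(y in @ball1 R)
     ((A `^ (k - k'))%:E * (vnorm (ds_fun f y) `^ k')%:E + (A `^ k)%:E))%E).
    apply: ge0_le_integral; [exact: mB|by move=> y _; rewrite lee_fin powR_ge0|exact: mFk| |].
      by apply: emeasurable_funD; [exact: measurable_funeM|exact: measurable_cst].
    move=> y _; rewrite -EFinM -EFinD lee_fin.
    set t := vnorm _; have t0 : 0 <= t by exact: vnorm_ge0.
    have [tA|At] := leP t A.
      rewrite ler_wpDl ?mulr_ge0 ?powR_ge0//.
      by apply: ge0_ler_powR; rewrite ?nnegrE ?(ltW k0) ?(ltW A0).
    have t1 : 0 < t by exact: lt_trans At.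
    have tE : t `^ k = t `^ (k - k') * t `^ k' by rewrite -powRD ?subrK// (gt_eqF t1) implybT.
    rewrite ler_wpDr ?powR_ge0// tE ler_wpM2r ?powR_ge0//.
    rewrite -(opprB k' k) !powRN lef_pV2 ?posrE ?powR_gt0//.
    by apply: ge0_ler_powR; rewrite ?nnegrE ?(ltW A0) ?(ltW t1) ?(ltW At) ?subr_ge0.
  rewrite ge0_integralD; [|exact: mB|
    by move=> y _; rewrite -EFinM lee_fin mulr_ge0 ?powR_ge0|exact: measurable_funeM|
    by move=> y _; rewrite lee_fin powR_ge0|exact: measurable_cst].
  rewrite ge0_integralZl; [|exact: mB|exact: mFk|by move=> y _; rewrite lee_fin powR_ge0|
    by rewrite lee_fin powR_ge0].
  rewrite integral_cst// BE.
  apply: (@le_trans _ _ ((A `^ (k - k'))%:E * (C * A `^ k')%:E + (A `^ k)%:E * B%:E)%E).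
    by apply: leeD => //; apply: lee_wpmul2l => //; rewrite lee_fin powR_ge0.
  rewrite -!EFinM -EFinD lee_fin mulrCA -powRD ?(gt_eqF A0) ?implybT// subrK.
  by rewrite /C' mulrDl (mulrC B).
exists (C' `^ k^-1); first exact: powR_gt0.
move=> f; rewrite /Lnorm_ball.
set J := (\int[_]_(x in _) _)%E; set I := (\int[_]_(x in _) _)%E.
have I0 : (0 <= I)%E by apply: integral_ge0 => y _; rewrite lee_fin powR_ge0.
have J0 : (0 <= J)%E by apply: integral_ge0 => y _; rewrite lee_fin powR_ge0.
have [Ioo|Ifin] := eqVneq I +oo%E.
  by rewrite Ioo poweRyr ?invr_neq0 ?lt0r_neq0// gt0_muley ?lte_fin ?powR_gt0// leey.
have [i i0 IE] : exists2 i : R, 0 <= i & I = i%:E.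
  by case: (I) I0 Ifin => [i| |] //; exists i.
rewrite IE poweR_EFin -EFinM; apply/lee_addgt0Pr => e e0.
(* Positive even when the Dirac norm is zero; the excess is scaled so that multiplication by the
   final constant [C'^(1/k)] returns exactly [e]. *)
pose A := i `^ p^-1 + e / C' `^ k^-1.
have A0 : 0 < A by rewrite ltr_wpDl ?powR_ge0// divr_gt0 ?powR_gt0.
have IA : (I <= (A `^ p)%:E)%E.
  rewrite IE lee_fin -[leLHS]powRr1// -(mulVf (lt0r_neq0 p0)) powRrM.
  apply: ge0_ler_powR; rewrite ?nnegrE ?powR_ge0 ?(ltW p0) ?(ltW A0)//.
  by rewrite /A lerDl divr_ge0 ?powR_ge0// ltW.
have JA := main f A A0 IA.
have : (J `^ k^-1 <= (C' * A `^ k)%:E `^ k^-1)%E.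
  apply: gt0_ler_poweR => //; rewrite ?invr_ge0 ?(ltW k0)// in_itv/= leey andbT//.
  by rewrite lee_fin mulr_ge0 ?powR_ge0// ltW.
rewrite poweR_EFin => /le_trans; apply.
rewrite -EFinD lee_fin powRM ?powR_ge0 ?(ltW C'0)// -powRrM mulfV ?lt0r_neq0// powRr1 ?(ltW A0)//.
by rewrite /A mulrDr lerD2l mulrCA mulfV ?mulr1// lt0r_neq0// powR_gt0.
Qed.
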